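(* Let $M=\{1^{k_1},2^{k_2},\ldots,n^{k_n}\}$ be a multiset with $n\ge1$ and $k_1,\ldots,k_n$ positive integers. Let $K=k_1+\cdots+k_n$ and let $s\ge2$ be an integer. Then the number of quasi-Stirling permutations in $\overline{Q}_M$ avoiding the pattern $\underline{s\cdots21}$ is $p_s(0;n,K-n+1)$. Furthermore, the sequence $p_s(0;n,k)$ satisfies the recurrence \begin{align*} p_s(0;n,k)=&\sum_{m=1}^{\lfloor n/s\rfloor}\left(-\left(\binom{n-1}{sm}p_s(0;n-sm,k)+\binom{n-1}{sm-1}p_s(0;n-sm+1,k-1)\right)\right.\\ &\left.+\left(\binom{n-1}{sm+1}p_s(0;n-sm-1,k)+\binom{n-1}{sm}p_s(0;n-sm,k-1)\right)\right)\\ &+\left((n-1)p_s(0;n-1,k)+p_s(0;n,k-1)\right) \end{align*} for $n\ge s$ and $k\ge1$, and $p_s(0;n,0)=p_s(0;n-1,1)$ for $n\ge2$. The initial conditions are $p_s(0;n,k)=(n+k-1)!/k!$ for $1\le n\le s-1$ and $k\ge0$, and $p_s(0;n,k)=0$ whenever $n\le0$ or $k<0$. Let $\hat{\mathcal{W}}_s(x)=\frac{-x^s+x}{1-x^s}\odot_xe^x$. Then the exponential generating function $\mathcal{P}_s(0,x,y)=\sum_{n\ge1,\,k\ge0}\frac{p_s(0;n,k)}{(n-1)!}x^ny^k$ is given by $$\mathcal{P}_s(0,x,y)=\frac{x}{1-\hat{\mathcal{W}}_s(x)-y\cdot\hat{\mathcal{W}}_s'(x)},$$ where the prime denotes differentiation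 with respect to $x$.
   Context: $\{1^{k_1},\ldots,n^{k_n}\}$ denotes the multiset containing $k_\ell$ copies of the letter $\ell$ for each $\ell\in\{1,\ldots,n\}$; exponents equal to $1$ are omitted. A permutation (multipermutation) of $M$ is a word $\pi=\pi_1\cdots\pi_{|M|}$ in which each letter $\ell$ occurs exactly $k_\ell$ times; $S_M$ is the set of all of them. It is quasi-Stirling if there are no indices $j_1<j_2<j_3<j_4$ with $\pi_{j_1}=\pi_{j_3}$, $\pi_{j_2}=\pi_{j_4}$ and $\pi_{j_1}\ne\pi_{j_2}$. $\overline{Q}_M$ is the set of quasi-Stirling permutations of $M$. $(\underline{s\cdots21})\pi$ is the number of indices $j$ such that $1\le j\le|M|-s+1$ and $\pi_j>\pi_{j+1}>\cdots>\pi_{j+s-1}$; $\pi$ avoids the pattern $\underline{s\cdots21}$ if this number is $0$. For $n\ge1$, $k\ge0$, with $M'=\{1^k,2,\ldots,n\}$, define $p_s(t;n,k)=\sum_{\pi\in S_{M'}}t^{(\underline{s\cdots21})\pi}$, so that $p_s(0;n,k)$ is its value at $t=0$, i.e. the number of $\pi\in S_{M'}$ avoiding $\underline{s\cdots21}$ (for $n=1,k=0$ the only permutation is the empty word); $p_s(0;n,k)$ is set to $0$ if $n\le0$ or $k<0$. The Hadamard product of $f(x)=\sum_{n\ge0}f_nx^n$ and $g(x)=\sum_{n\ge0}g_nx^n$ is $f(x)\odot_xg(x)=\sum_{n\ge0}f_ng_nx^n$. All generating functions are formal power series. *)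

(* Defs.v *)
From HB Require Import structures.
From mathcomp Require Import all_boot all_order all_algebra.
From mathcomp Require Import boolp.

Set Implicit Arguments.
Unset Strict Implicit.
Unset Printing Implicit Defensive.

Import Order.TTheory GRing.Theory Num.Theory.

Local Open Scope ring_scope.

Record fps (R : Type) := Fps { fps_coef : nat -> R }.

(* The bivariate series R[[x, y]] are rendered as R[[x]][[y]]. *)
Notation "{ 'fps' R }" := (fps R) (at level 0, format "{ 'fps'  R }").
Notation "f `[ n ]" := (fps_coef f n)
  (at level 1, left associativity, format "f `[ n ]") : ring_scope.

Lemma fpsP (R : Type) (f g : {fps R}) : (forall n, f`[n] = g`[n]) <-> f = g.
Proof.
split=> [|-> //]; case: f g => [f] [g] /= fg.
by congr Fps; apply: funext.
Qed.

HB.instance Definition _ (R : Type) := gen_eqMixin (fps R).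
HB.instance Definition _ (R : Type) := gen_choiceMixin (fps R).

Section FpsZmodule.
Variable R : zmodType.
Implicit Types f g h : {fps R}.

Definition fps_zero : {fps R} := Fps (fun=> 0).
Definition fps_opp f : {fps R} := Fps (fun n => - f`[n]).
Definition fps_add f g : {fps R} := Fps (fun n => f`[n] + g`[n]).

Fact fps_addA : associative fps_add.
Proof. by move=> f g h; apply/fpsP=> n /=; rewrite addrA. Qed.
Fact fps_addC : commutative fps_add.
Proof. by move=> f g; apply/fpsP=> n /=; rewrite addrC. Qed.
Fact fps_add0 : left_id fps_zero fps_add.
Proof. by move=> f; apply/fpsP=> n /=; rewrite add0r. Qed.
Fact fps_addN : left_inverse fps_zero fps_opp fps_add.
Proof. by move=> f; apply/fpsP=> n /=; rewrite addNr. Qed.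

HB.instance Definition _ := GRing.isZmodule.Build (fps R)
  fps_addA fps_addC fps_add0 fps_addN.

Lemma fps_coef0 n : (0 : {fps R})`[n] = 0. Proof. by []. Qed.
Lemma fps_coefN f n : (- f)`[n] = - f`[n]. Proof. by []. Qed.
Lemma fps_coefD f g n : (f + g)`[n] = f`[n] + g`[n]. Proof. by []. Qed.
Lemma fps_coefB f g n : (f - g)`[n] = f`[n] - g`[n]. Proof. by []. Qed.

End FpsZmodule.

Section FpsRing.
Variable R : comNzRingType.
Implicit Types f g h : {fps R}.

Definition fps_const (c : R) : {fps R} := Fps (fun n => if n == 0%N then c else 0).
Definition fps_mul f g : {fps R} :=
  Fps (fun n => \sum_(i < n.+1) f`[i] * g`[n - i]).

Fact fps_mul_rev f g n :
  (fps_mul f g)`[n] = \sum_(i < n.+1) f`[n - i] * g`[i].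
Proof.
rewrite /= (reindex_inj rev_ord_inj) /=; apply: eq_bigr => i _.
by rewrite subSS subKn // leq_ord.
Qed.

Fact fps_mulC : commutative fps_mul.
Proof.
move=> f g; apply/fpsP=> n; rewrite fps_mul_rev.
by apply: eq_bigr => i _; rewrite mulrC.
Qed.

Fact fps_mulA : associative fps_mul.
Proof.
move=> f g h; apply/fpsP=> n; rewrite [RHS]fps_mul_rev.
pose F j k := f`[j] * (g`[n - j - k] * h`[k]).
transitivity (\sum_(j < n.+1) \sum_(k < n.+1 | (k <= n - j)%N) F j k).
  apply: eq_bigr => j _; rewrite fps_mul_rev big_distrr /=.
  by rewrite (big_ord_narrow_leq (leq_subr _ _)).
rewrite (exchange_big_dep predT) //=; apply: eq_bigr => k _.
transitivity (\sum_(j < n.+1 | (j <= n - k)%N) F j k).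
  apply: eq_bigl => j; rewrite -ltnS -(ltnS j) -!subSn ?leq_ord //.
  by rewrite -subn_gt0 -(subn_gt0 j) -!subnDA addnC.
rewrite (big_ord_narrow_leq (leq_subr _ _)) big_distrl /=.
by apply: eq_bigr => j _; rewrite /F -!subnDA addnC mulrA.
Qed.

Fact fps_mul1 : left_id (fps_const 1) fps_mul.
Proof.
move=> f; apply/fpsP=> n /=; rewrite big_ord_recl /= mul1r subn0.
by rewrite big1 ?addr0 // => i _; rewrite mul0r.
Qed.

Fact fps_mulDl : left_distributive fps_mul +%R.
Proof.
move=> f g h; apply/fpsP=> n /=; rewrite -big_split /=.
by apply: eq_bigr => i _; rewrite mulrDl.
Qed.

Fact fps_1_neq0 : fps_const 1 != 0.
Proof. by apply/eqP => /fpsP /(_ 0%N) /= /eqP; rewrite oner_eq0. Qed.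

HB.instance Definition _ := GRing.Zmodule_isComNzRing.Build (fps R)
  fps_mulA fps_mulC fps_mul1 fps_mulDl fps_1_neq0.

Lemma fps_coef1 n : (1 : {fps R})`[n] = (n == 0%N)%:R.
Proof. by rewrite /=; case: eqP. Qed.
Lemma fps_coefC c n : (fps_const c)`[n] = c *+ (n == 0%N).
Proof. by rewrite /=; case: eqP. Qed.
Lemma fps_coefM f g n : (f * g)`[n] = \sum_(i < n.+1) f`[i] * g`[n - i].
Proof. by []. Qed.

Definition fpsX : {fps R} := Fps (fun n => (n == 1%N)%:R).

Definition fps_deriv f : {fps R} := Fps (fun n => f`[n.+1] *+ n.+1).

Definition hadamard f g : {fps R} := Fps (fun n => f`[n] * g`[n]).

End FpsRing.

Arguments fpsX {R}.

Section FpsUnitRing.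
Variable R : comUnitRingType.
Implicit Types f g h : {fps R}.

Definition fps_unit : pred {fps R} := [pred f | f`[0] \is a GRing.unit].

(* The first n.+1 coefficients of 1 / f, by solving f * g = 1 degree by
   degree. *)
Fixpoint fps_inv_seq f (n : nat) : seq R :=
  if n is m.+1 then
    let g := fps_inv_seq f m in
    rcons g (- (f`[0])^-1 * \sum_(i < m.+1) f`[i.+1] * g`_(m - i))
  else [:: (f`[0])^-1].

(* MathComp requires the inverse of a non-unit to be itself. *)
Definition fps_inv f : {fps R} :=
  if fps_unit f then Fps (fun n => (fps_inv_seq f n)`_n) else f.

Lemma size_fps_inv_seq f n : size (fps_inv_seq f n) = n.+1.
Proof. by elim: n => //= n IHn; rewrite size_rcons IHn. Qed.

Lemma nth_fps_inv_seq f m n : (m <= n)%N ->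
  (fps_inv_seq f n)`_m = (fps_inv_seq f m)`_m.
Proof.
elim: n => [|n IHn]; first by rewrite leqn0 => /eqP->.
rewrite leq_eqVlt => /predU1P[-> //|lt_mn].
by rewrite /= nth_rcons size_fps_inv_seq lt_mn IHn.
Qed.

Fact fps_mulVr : {in fps_unit, left_inverse 1 fps_inv *%R}.
Proof.
move=> f Uf; have Uf0 : f`[0] \is a GRing.unit by [].
rewrite mulrC; apply/fpsP=> -[|n].
  by rewrite fps_coefM big_ord1 /fps_inv ifT //= divrr.
rewrite fps_coefM fps_coef1 /= big_ord_recl subn0 /= /fps_inv ifT //=.
rewrite nth_rcons size_fps_inv_seq ltnn eqxx mulrA mulrN divrr // mulN1r.
apply/eqP; rewrite addrC subr_eq0; apply/eqP; apply: eq_bigr => i _.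
by rewrite /= /bump leq0n add1n subSS [in RHS]nth_fps_inv_seq ?leq_subr.
Qed.

Fact fps_unitPl f g : g * f = 1 -> fps_unit f.
Proof.
move/fpsP/(_ 0%N); rewrite fps_coefM fps_coef1 big_ord1 /= => gf1.
by apply/unitrPr; exists g`[0]; rewrite mulrC.
Qed.

Fact fps_inv_out : {in [predC fps_unit], fps_inv =1 id}.
Proof. by move=> f nUf; rewrite /fps_inv ifN. Qed.

HB.instance Definition _ := GRing.ComNzRing_hasMulInverse.Build (fps R)
  fps_mulVr fps_unitPl fps_inv_out.

Lemma fps_unitE f : (f \is a GRing.unit) = (f`[0] \is a GRing.unit).
Proof. by []. Qed.

End FpsUnitRing.

Definition fps_exp : {fps rat} := Fps (fun n => (n`!%:R)^-1).

(* The multiset {1^(k 1), ..., n^(k n)}, as its weakly increasing word; the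
   values of k outside {1, ..., n} are irrelevant. *)
Definition mset_word (n : nat) (k : nat -> nat) : seq nat :=
  flatten [seq nseq (k l) l | l <- iota 1 n].

(* S_M, as a duplicate-free list of words. *)
Definition multiperms (n : nat) (k : nat -> nat) : seq (seq nat) :=
  permutations (mset_word n k).

Definition quasi_stirling (w : seq nat) : bool :=
  ~~ [exists j1 : 'I_(size w), exists j2 : 'I_(size w),
      exists j3 : 'I_(size w), exists j4 : 'I_(size w),
      [&& (j1 < j2)%N, (j2 < j3)%N, (j3 < j4)%N,
          nth 0%N w j1 == nth 0%N w j3, nth 0%N w j2 == nth 0%N w j4
        & nth 0%N w j1 != nth 0%N w j2]].

(* Number of occurrences of the consecutive pattern s...21; positions are
   numbered from 0, so they range over 0 <= j < |w| - s + 1. *)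
Definition desc_occ (s : nat) (w : seq nat) : nat :=
  count (fun j => sorted gtn (take s (drop j w))) (iota 0 ((size w).+1 - s)).

Definition avoids (s : nat) (w : seq nat) : bool := desc_occ s w == 0%N.

Definition quasi_stirling_perms (n : nat) (k : nat -> nat) : seq (seq nat) :=
  [seq w <- multiperms n k | quasi_stirling w].

Definition p_poly (s n k : nat) : {poly int} :=
  \sum_(w <- multiperms n (fun l => if l == 1%N then k else 1%N))
    'X^(desc_occ s w).

(* p_s(0; n, k), extended by 0 to n <= 0 or k < 0. *)
Definition p0 (s : nat) (n k : int) : int :=
  match n, k with
  | Posz n'.+1, Posz k' => (p_poly s n'.+1 k').[0]
  | _, _ => 0
  end.

Definition W_hat (s : nat) : {fps rat} :=
  hadamard ((- fpsX ^+ s + fpsX) / (1 - fpsX ^+ s)) fps_exp.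

(* The outer index is the exponent of y, the inner one that of x. *)
Definition P_egf (s : nat) : {fps {fps rat}} :=
  Fps (fun k : nat => Fps (fun n : nat =>
    if (1 <= n)%N then (p0 s n%:Z k%:Z)%:~R / (n.-1)`!%:R else 0)).

Definition var_x : {fps {fps rat}} := fps_const fpsX.
Definition var_y : {fps {fps rat}} := fpsX.

(* Main.v *)
(* Write c_l for the coefficient of x^l in (x - x^s)/(1 - x^s). Since
   1/(1 - sum_l c_l x^l) = 1 + x + ... + x^(s-1), the indicator of a word having
   no s consecutive descending letters is the sum of prod_i c_(l_i) over the ways
   to cut the word into strictly decreasing segments of lengths l_i.
   Let W = sum_l c_l x^l/l!, u = 1/(1 - W) and phi = u W', so that u' = phi u.
   Reading a quasi-Stirling word with a stack of pending occurrences, and cutting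
   it at the segment that contains the innermost pending one, shows that the
   avoiding words over sets of letters x of multiplicities d(x) + 1 have
   generating function u(t), where t = sum_x x phi(t)^d(x). By Lagrange inversion
   its coefficient on n letters is the (n-1)-st derivative at 0 of u phi^(D+1)
   with D = sum_x d(x), which only depends on n and D. A word with a single
   repeated letter is always quasi-Stirling, so this number is p_s(0; n, D + 1);
   summing over D gives the generating function, and the recurrence follows. *)
Require Import Defs.
From HB Require Import structures.
From mathcomp Require Import all_boot all_order all_algebra.
From mathcomp Require Import ring zify.

Set Implicit Arguments.
Unset Strict Implicit.
Unset Printing Implicit Defensive.

Import Order.TTheory GRing.Theory Num.Theory.

Local Open Scope ring_scope.

(** * Formal power series and Lagrange inversion *)

Section FpsCalculus.
Variable R : comNzRingType.
Implicit Types f g : {fps R}.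

Lemma fps_coefMn f m n : (f *+ m)`[n] = f`[n] *+ m.
Proof. by elim: m => [|m IHm]; rewrite ?mulr0n // !mulrS fps_coefD IHm. Qed.

Lemma fps_coefCM c f n : (fps_const c * f)`[n] = c * f`[n].
Proof.
rewrite fps_coefM big_ord_recl /= subn0 big1 ?addr0 // => i _.
by rewrite /= mul0r.
Qed.

Lemma fps_coef0M f g : (f * g)`[0] = f`[0] * g`[0].
Proof. by rewrite fps_coefM big_ord1. Qed.

Lemma fps_coefXM f n : (fpsX * f)`[n.+1] = f`[n].
Proof.
rewrite fps_coefM 2!big_ord_recl /= mul0r mul1r add0r subn1 /=.
by rewrite big1 ?addr0 // => i _; rewrite mul0r.
Qed.

Lemma fps_coef0XM f : (fpsX * f)`[0] = 0.
Proof. by rewrite fps_coef0M mul0r. Qed.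

Lemma fps_coefXn m n : ((fpsX : {fps R}) ^+ m)`[n] = (n == m)%:R.
Proof.
elim: m n => [|m IHm] n; first by rewrite fps_coef1.
by rewrite exprS; case: n => [|n]; rewrite ?fps_coef0XM ?fps_coefXM ?IHm.
Qed.

Definition fps_shift f : {fps R} := Fps (fun n => f`[n.+1]).

Lemma fps_shiftE f : f = fps_const f`[0] + fpsX * fps_shift f.
Proof.
apply/fpsP=> -[|n]; first by rewrite fps_coefD fps_coef0XM addr0.
by rewrite fps_coefD fps_coefXM add0r.
Qed.

Lemma fps_derivD f g : fps_deriv (f + g) = fps_deriv f + fps_deriv g.
Proof. by apply/fpsP=> n; rewrite fps_coefD /= mulrnDl. Qed.

Lemma fps_derivC c : fps_deriv (fps_const c) = 0 :> {fps R}.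
Proof. by apply/fpsP=> n; rewrite /= mul0rn. Qed.

Lemma fps_derivM f g : fps_deriv (f * g) = fps_deriv f * g + f * fps_deriv g.
Proof.
apply/fpsP=> n; rewrite fps_coefD !fps_coefM.
rewrite [LHS]/= -sumrMnl.
under eq_bigr => i _ do
  rewrite -[in X in _ *+ X](subnKC (ltn_ord i : (i <= n.+1)%N)) mulrnDr.
rewrite big_split /= big_ord_recl mulr0n add0r; congr (_ + _).
  by apply: eq_bigr => i _; rewrite /= mulrnAl subSS.
rewrite big_ord_recr /= subnn mulr0n addr0; apply: eq_bigr => i _.
by rewrite mulrnAr subSn // -ltnS.
Qed.

Lemma fps_derivN f : fps_deriv (- f) = - fps_deriv f.
Proof. by apply/fpsP=> n; rewrite fps_coefN /= mulNrn. Qed.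

Lemma fps_deriv1 : fps_deriv (1 : {fps R}) = 0.
Proof. exact: fps_derivC. Qed.

Lemma fps_derivX : fps_deriv (fpsX : {fps R}) = 1.
Proof. by apply/fpsP=> -[|n]; rewrite fps_coef1 /= ?mul0rn. Qed.

Lemma fps_derivXn f n :
  fps_deriv (f ^+ n) = f ^+ n.-1 * fps_deriv f *+ n.
Proof.
elim: n => [|[|n] IHn]; first by rewrite expr0 fps_deriv1.
  by rewrite expr1 expr0 mul1r.
rewrite exprS fps_derivM IHn /= mulrnAr mulrA -exprS [RHS]mulrS.
by congr (_ + _); rewrite mulrC.
Qed.

End FpsCalculus.

(** A letter together with a set avoiding it is the same as a set with a marked element. This
    regroups the recursions below that peel off one letter. *)
Lemma exchange_big_setD1 (R : nmodType) (I : finType) (N : {set I})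
    (F : I -> {set I} -> R) :
  \sum_(x in N) \sum_(A : {set I} | A \subset N :\ x) F x A
  = \sum_(A : {set I} | A \subset N) \sum_(x in A) F x (A :\ x).
Proof.
rewrite [RHS](exchange_big_dep (mem N)) /=; last first.
  by move=> A x /subsetP AN /AN.
apply: eq_bigr => x xN.
rewrite [RHS](reindex_onto (fun A => x |: A) (fun A => A :\ x)) /=; last first.
  by move=> A /andP[_ xA]; rewrite setD1K.
apply: eq_big => [A|A]; last first.
  by rewrite subsetD1 => /andP[_ xA]; rewrite setU1K.
rewrite subUset sub1set xN setU11 /= andbT subsetD1.
case xA: (x \in A); last by rewrite setU1K ?xA ?eqxx.
rewrite andbF; apply/esym/negbTE; rewrite negb_and; apply/orP; right.
by apply/eqP => /setP /(_ x); rewrite !inE eqxx xA.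
Qed.

(** * Lagrange inversion with one variable per letter, for squarefree monomials *)

Section Lagrange.
Variables (I : finType) (d : I -> nat) (phi : {fps rat}).
Implicit Types (A N T : {set I}) (H : {fps rat}).

Definition weight N := (\sum_(x in N) d x)%N.

Lemma weightD1 N x : x \in N -> weight N = (d x + weight (N :\ x))%N.
Proof. by move=> xN; rewrite /weight (big_setD1 x). Qed.

Lemma weight_set0 : weight set0 = 0%N.
Proof. by rewrite /weight big_set0. Qed.

(* By Lagrange-Buermann, the coefficient of prod_(x in N) x in H(t), where
   t = sum_x x * phi(t)^(d x). *)
Definition lagrange H N : rat :=
  if N == set0 then H`[0]
  else (#|N|.-1)`!%:R * (fps_deriv H * phi ^+ weight N)`[#|N|.-1].

Lemma lagrange_set0 H : lagrange H set0 = H`[0].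
Proof. by rewrite /lagrange eqxx. Qed.

Lemma lagrangeD H1 H2 N : lagrange (H1 + H2) N = lagrange H1 N + lagrange H2 N.
Proof.
rewrite /lagrange; case: ifP => _; first by rewrite fps_coefD.
by rewrite fps_derivD mulrDl fps_coefD mulrDr.
Qed.

Lemma lagrangeC c N : lagrange (fps_const c) N = c *+ (N == set0).
Proof.
by rewrite /lagrange; case: ifP => // _; rewrite fps_derivC mul0r mulr0.
Qed.

Lemma lagrangeCM c H N : lagrange (fps_const c * H) N = c * lagrange H N.
Proof.
rewrite /lagrange; case: ifP => _; first by rewrite fps_coefCM.
by rewrite fps_derivM fps_derivC mul0r add0r -mulrA fps_coefCM mulrCA.
Qed.

(** This is t H(t) = sum_x x phi(t)^(d x) H(t) read off coefficientwise, and it drives both product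
    formulas below. As [lagrange] is a closed formula, the identity is checked by m [x^m] F =
    [x^(m-1)] F' for F = H phi^weight. *)
Lemma lagrangeXM H N :
  lagrange (fpsX * H) N = \sum_(x in N) lagrange (phi ^+ d x * H) (N :\ x).
Proof.
have [->|/set0Pn[x0 x0N]] := eqVneq N set0.
  by rewrite big_set0 lagrange_set0 fps_coef0XM.
have cardN : #|N| = #|N :\ x0|.+1 by rewrite (cardsD1 x0) x0N.
rewrite {1}/lagrange -if_neg ifT; last by apply/set0Pn; exists x0.
rewrite cardN succnK fps_derivM fps_derivX mul1r.
case En: #|N :\ x0| => [|n].
  have N1 : N = [set x0].
    by apply/eqP; rewrite eq_sym eqEcard sub1set x0N cards1 cardN En.
  rewrite fact0 mul1r N1 big_set1 setDv lagrange_set0.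
  rewrite fps_coef0M fps_coefD fps_coef0XM addr0 /weight big_set1.
  by rewrite fps_coef0M mulrC.
(* Summing over [x] turns the factors [d x] into the weight of [N], and repeats the other term #|N|
   = n + 2 times. *)
transitivity (n`!%:R * \sum_(x in N)
  ((phi ^+ (weight N).-1 * fps_deriv phi * H) *+ d x
   + phi ^+ weight N * fps_deriv H)`[n]); last first.
  rewrite mulr_sumr; apply: eq_bigr => x xN.
  have cardNx : #|N :\ x| = n.+1.
    by move: cardN; rewrite (cardsD1 x) xN En => -[].
  rewrite /lagrange -if_neg ifT; last by rewrite -card_gt0 cardNx.
  rewrite cardNx succnK (weightD1 xN); congr (_ * (_)`[n]).
  rewrite fps_derivM fps_derivXn mulrDl exprD mulrnAl mulrnAl.
  congr (_ + _); last by rewrite -!mulrA; congr (_ * _); rewrite mulrC.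
  by case: (d x) => [|e]; rewrite ?mulr0n //= exprD; congr (_ *+ _); ring.
under [in RHS]eq_bigr => x _ do rewrite fps_coefD fps_coefMn.
rewrite big_split sumr_const cardN En mulrDl fps_coefD -mulrA fps_coefXM.
rewrite sumrMnr -/(weight N) factS natrM -mulrA mulrCA mulrDr.
have -> : n.+1%:R * (H * phi ^+ weight N)`[n.+1]
        = (fps_deriv (H * phi ^+ weight N))`[n] by rewrite mulr_natl.
rewrite fps_derivM fps_derivXn fps_coefD mulrnAr fps_coefMn.
rewrite [H * (_ * _)]mulrC [phi ^+ _ * fps_deriv H]mulrC; congr (_ * _).
rewrite mulr_natl [X in X *+ _.+2]lock mulrSr -lock.
by rewrite [LHS]addrAC addrC mulrS; congr (_ + _); rewrite addrC.
Qed.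

Lemma setD1D1 N A (x : I) : x \in A -> (N :\ x) :\: (A :\ x) = N :\: A.
Proof.
by move=> xA; apply/setP=> y; rewrite !inE; case: eqP => // ->; rewrite xA.
Qed.

(** Coefficients of a product convolve over subsets. The constant term of [G] is split off, and the
    remaining factor t is traded for a letter by [lagrangeXM], which shrinks [N]. *)
Lemma lagrangeM G H N :
  lagrange (G * H) N
  = \sum_(A : {set I} | A \subset N) lagrange G A * lagrange H (N :\: A).
Proof.
have [n] := ubnP #|N|; elim: n => // n IHn in N G *; rewrite ltnS => leNn.
rewrite [G in LHS]fps_shiftE mulrDl lagrangeD lagrangeCM -mulrA lagrangeXM.
rewrite (eq_bigr (fun x => \sum_(A : {set I} | A \subset N :\ x)
    lagrange (phi ^+ d x * fps_shift G) A * lagrange H ((N :\ x) :\: A)));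
  last first.
  move=> x xN; rewrite mulrA IHn //.
  by apply: leq_trans leNn; rewrite (cardsD1 x N) xN.
rewrite (exchange_big_setD1 N (fun x A => lagrange (phi ^+ d x * fps_shift G) A
           * lagrange H ((N :\ x) :\: A))).
rewrite [RHS](eq_bigr (fun A => G`[0] *+ (A == set0) * lagrange H (N :\: A)
    + \sum_(x in A) lagrange (phi ^+ d x * fps_shift G) (A :\ x)
        * lagrange H (N :\: A))) => [|A _]; last first.
  rewrite [G in LHS]fps_shiftE lagrangeD mulrDl lagrangeC lagrangeXM.
  by rewrite mulr_suml.
rewrite big_split; congr (_ + _); last first.
  by apply: eq_bigr => A _; apply: eq_bigr => x xA; rewrite setD1D1.
rewrite (bigD1 set0) ?sub0set //= eqxx mulr1n setD0 big1 ?addr0 // => A.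
by case/andP=> _ /negPf->; rewrite mul0r.
Qed.

Definition egf (v : nat -> rat) : {fps rat} := Fps (fun l => v l / l`!%:R).

(** In t^l / l! = (sum_x x phi(t)^(d x))^l / l!, the terms with distinct letters are indexed by
    l-element sets, the factorial cancelling their orderings. *)
Lemma lagrange_egfM v H N :
  lagrange (egf v * H) N
  = \sum_(T : {set I} | T \subset N)
      v #|T| * lagrange (phi ^+ weight T * H) (N :\: T).
Proof.
have [n] := ubnP #|N|; elim: n => // n IHn in N v H *; rewrite ltnS => leNn.
pose v1 l := v l.+1 / l.+1%:R.
have -> : egf v = fps_const (v 0%N) + fpsX * egf v1.
  rewrite [LHS]fps_shiftE; congr (fps_const _ + fpsX * _).
    by rewrite /= divr1.
  apply/fpsP=> l; rewrite /= /v1 factS natrM invfM.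
  by rewrite mulrA.
rewrite mulrDl lagrangeD lagrangeCM -mulrA lagrangeXM.
rewrite (eq_bigr (fun x => \sum_(T : {set I} | T \subset N :\ x)
    v1 #|T| * lagrange (phi ^+ weight T * (phi ^+ d x * H)) ((N :\ x) :\: T)));
  last first.
  move=> x xN; rewrite mulrCA IHn //.
  by apply: leq_trans leNn; rewrite (cardsD1 x N) xN.
rewrite (exchange_big_setD1 N (fun x T => v1 #|T| *
   lagrange (phi ^+ weight T * (phi ^+ d x * H)) ((N :\ x) :\: T))).
rewrite [RHS](bigD1 set0) ?sub0set //= cards0 weight_set0 expr0 mul1r setD0.
congr (_ + _); rewrite [LHS](bigD1 set0) ?sub0set //= big_set0 add0r.
apply: eq_bigr => T /andP[_ T0].
have {}T0 : #|T|%:R != 0 :> rat by rewrite pnatr_eq0 cards_eq0.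
(* Each of the #|T| choices of the peeled letter gives the same term, which cancels the division in
   [v1]. *)
rewrite (eq_bigr (fun=> v #|T| / #|T|%:R *
    lagrange (phi ^+ weight T * H) (N :\: T))) => [|x xT].
  by rewrite sumr_const -[LHS]mulr_natl mulrA mulrCA divff // mulr1.
rewrite /v1 setD1D1 // mulrA -exprD addnC -weightD1 //.
by rewrite (cardsD1 x T) xT.
Qed.

End Lagrange.

(** * Words avoiding long decreasing runs *)

Lemma dropl_cat (T : Type) n (s1 s2 : seq T) :
  (n <= size s1)%N -> drop n (s1 ++ s2) = drop n s1 ++ s2.
Proof.
rewrite leq_eqVlt drop_cat => /predU1P[->|->] //.
by rewrite ltnn subnn drop0 drop_size.
Qed.

Section Avoidance.
Variables (s : nat) (T : Type).
Hypothesis s_gt1 : (1 < s)%N.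
Implicit Types (r : rel T) (x e : T) (w v : seq T).

Let s_gt0 : (0 < s)%N. Proof. exact: ltnW. Qed.

Fixpoint run_from r x w : nat :=
  if w is y :: w' then if r x y then (run_from r y w').+1 else 1%N else 1%N.

(** The maximal chain starting at each letter, that letter included, is shorter than s. This form
    suits the removal of a first segment. *)
Fixpoint avoid r w : bool :=
  if w is x :: w' then (run_from r x w' < s)%N && avoid r w' else true.

Lemma run_from_gt0 r x w : (0 < run_from r x w)%N.
Proof. by case: w => //= y w; case: ifP. Qed.

Lemma run_from_leq_size r x w : (run_from r x w <= (size w).+1)%N.
Proof. by elim: w x => //= y w IHw x; case: ifP => // _; apply: IHw. Qed.

Lemma path_take_run r x w i : (i <= size w)%N ->
  path r x (take i w) = (i < run_from r x w)%N.
Proof.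
elim: w x i => [|y w IHw] x [|i] //= lei.
  by case: ifP.
by case: ifP => // _; rewrite IHw.
Qed.

(** Dropping [i] letters from an initial run of length R leaves a run of length R - i, and the later
    starting points inside the run are less restrictive. *)
Lemma avoid_drop r x w i : (i <= run_from r x w)%N ->
  avoid r (drop i (x :: w))
  = (run_from r x w - i < s)%N && avoid r (drop (run_from r x w) (x :: w)).
Proof.
elim: w x i => [|y w IHw] x [|[|i]] //=; rewrite ?s_gt0 ?s_gt1 //.
- have /= := IHw y 0%N isT; rewrite subn0.
  case: ifP => rxy /= avoidE _; last by rewrite subn0.
  by rewrite avoidE andbA subn0; congr (_ && _); lia.
- have /= := IHw y 0%N isT; rewrite subn0.
  by case: ifP => rxy /= avoidE _; rewrite ?subn1 ?subnn ?s_gt0 //.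
by case: ifP => // rxy; rewrite ltnS => lei; rewrite -(IHw y i.+1).
Qed.

(* The coefficients of (x - x^s) / (1 - x^s). *)
Definition run_weight l : rat :=
  (l %% s == 1)%N%:R - ((0 < l) && (s %| l))%N%:R.

(** The weights +1 at indices 1 mod s and -1 at positive multiples of s alternate, so the partial
    sums are 0 or 1. *)
Lemma sum_run_weight n :
  \sum_(i < n) run_weight i.+1 = (~~ (s %| n)%N)%:R.
Proof.
elim: n => [|n IHn]; first by rewrite big_ord0 dvdn0.
rewrite big_ord_recr /= {}IHn /run_weight modnS /=.
case: (boolP (s %| n.+1)%N) => sn1 /=; last first.
  by rewrite eqSS subr0 -/(dvdn s n); case: (s %| n)%N; rewrite ?add0r ?addr0.
rewrite sub0r; case: (boolP (s %| n)%N) => /= [sn|_]; last by rewrite subrr.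
have : (s %| 1)%N by rewrite -(dvdn_addr _ sn) addn1.
by rewrite dvdn1 => /eqP s1; move: s_gt1; rewrite s1.
Qed.

(** Coefficient form of (1 + x + ... + x^(s-1)) c(x) = x + ... + x^(s-1), with c the series of
    weights. For n >= s the sum is a difference of the partial sums at n and n - s, which agree. *)
Lemma sum_run_weight_window n : (0 < n)%N ->
  \sum_(i < n) run_weight i.+1 * (n - i.+1 < s)%N%:R = (n < s)%N%:R.
Proof.
move=> n_gt0; have [lens|lens] := ltnP n s.
  rewrite (eq_bigr (fun i : 'I_n => run_weight i.+1)) => [|i _].
    by rewrite sum_run_weight gtnNdvd.
  by rewrite (_ : (_ < s)%N = true) ?mulr1 //; lia.
have := sum_run_weight n.
rewrite -!(big_mkord xpredT (fun i => run_weight i.+1)).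
rewrite -(big_mkord xpredT (fun i => run_weight i.+1 * (n - i.+1 < s)%N%:R)).
rewrite !(big_cat_nat (leq0n (n - s)) (leq_subr s n)) /=.
rewrite (big_mkord xpredT (fun i => run_weight i.+1)) sum_run_weight.
rewrite dvdn_subl // => sumE.
rewrite big_nat big1 ?add0r => [|i ltin]; last first.
  by rewrite (_ : (_ < s)%N = false) ?mulr0 //; lia.
rewrite big_nat (eq_bigr (fun i => run_weight i.+1)) => [|i lein].
  by rewrite -big_nat; apply: (addrI (~~ (s %| n)%N)%:R); rewrite addr0.
by rewrite (_ : (_ < s)%N = true) ?mulr1 //; lia.
Qed.

(** A first segment must lie inside the initial run. By [avoid_drop] what follows it depends only on
    the length left of that run and on the suffix behind it, so the window sum applies. *)
Lemma avoid_rec r w : (0 < size w)%N ->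
  (avoid r w)%:R = \sum_(i < size w)
     (sorted r (take i.+1 w))%:R
     * (run_weight i.+1 * (avoid r (drop i.+1 w))%:R).
Proof.
case: w => // x w _; set w1 := x :: w; pose R := run_from r x w.
have leR : (R <= size w1)%N by apply: run_from_leq_size.
rewrite -[w1 in LHS]drop0 (avoid_drop (i := 0)) // subn0 -/R.
rewrite -(big_mkord xpredT (fun i => (sorted r (take i.+1 w1))%:R *
   (run_weight i.+1 * (avoid r (drop i.+1 w1))%:R))).
rewrite (big_cat_nat (leq0n R) leR) /= [X in _ = _ + X]big_nat.
rewrite [X in _ = _ + X]big1 ?addr0 => [|i /andP[leRi lti]]; last first.
  by rewrite path_take_run // ltnNge leRi mul0r.
rewrite -mulnb natrM -sum_run_weight_window ?run_from_gt0 //.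
rewrite mulr_suml big_mkord.
apply: eq_bigr => i _.
rewrite path_take_run; last by rewrite -ltnS (leq_trans (ltn_ord i)).
rewrite ltn_ord mul1r -mulrA -natrM mulnb; congr (_ * _%:R).
by rewrite -(avoid_drop (i := i.+1)).
Qed.

(** Among the weighted cuttings into segments, the segment through [e] is singled out; the cuttings
    before and after it sum to avoidance indicators again. *)
Lemma avoid_split_take r v e w :
  (avoid r (v ++ e :: w))%:R
  = \sum_(p < (size v).+1) \sum_(j < (size w).+1)
     (sorted r (drop p v ++ e :: take j w))%:R *
     (run_weight (size v - p + j).+1 *
      ((avoid r (take p v))%:R * (avoid r (drop j w))%:R)) :> rat.
Proof.
have [n] := ubnP (size v); elim: n => // n IHn in v *; rewrite ltnS => lesn.
have sz : size (v ++ e :: w) = (size v + (size w).+1)%N by rewrite size_cat.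
rewrite avoid_rec sz; last by rewrite addnS.
(* The first segment either reaches [e], which is the term p = 0, or ends inside [v]. *)
rewrite big_split_ord /= addrC [RHS]big_ord_recl; congr (_ + _).
  apply: eq_bigr => j _; rewrite drop0 take0 subn0 mul1r.
  rewrite -[in RHS](addnS (size v) j) take_cat drop_cat.
  by rewrite -addnS ltnNge leq_addr /= addKn.
transitivity (\sum_(l < size v) \sum_(p < size v | (l <= p)%N)
   \sum_(j < (size w).+1)
     (sorted r (take l.+1 v))%:R * run_weight l.+1 *
     (avoid r (drop l.+1 (take p.+1 v)))%:R *
     ((sorted r (drop p.+1 v ++ e :: take j w))%:R *
      (run_weight (size v - p.+1 + j).+1 * (avoid r (drop j w))%:R))).
  apply: eq_bigr => l _; rewrite takel_cat // dropl_cat // IHn; last first.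
    by rewrite size_drop; have := ltn_ord l; lia.
  rewrite size_drop subnSK //.
  rewrite -(big_mkord xpredT (fun p => \sum_(j < (size w).+1)
     (sorted r (drop p (drop l.+1 v) ++ e :: take j w))%:R *
     (run_weight (size v - l.+1 - p + j).+1 *
      ((avoid r (take p (drop l.+1 v)))%:R * (avoid r (drop j w))%:R)))).
  transitivity (\sum_(l <= p < size v) (sorted r (take l.+1 v))%:R *
     (run_weight l.+1 * \sum_(j < (size w).+1)
     (avoid r (drop l.+1 (take p.+1 v)))%:R *
     ((sorted r (drop p.+1 v ++ e :: take j w))%:R *
      (run_weight (size v - p.+1 + j).+1 * (avoid r (drop j w))%:R)))).
    rewrite -!mulr_sumr; congr (_ * (_ * _)).
    rewrite -[X in _ = \sum_(X <= p < _) _]add0n [RHS]big_addn.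
    apply: eq_bigr => p _.
    apply: eq_bigr => j _; rewrite take_drop drop_drop -subnDA.
    by rewrite [(l.+1 + p)%N]addnC !addnS; ring.
  rewrite big_geq_mkord; apply: eq_big => [p|p _]; first by [].
  rewrite mulrA mulr_sumr; apply: eq_bigr => j _; ring.
rewrite (exchange_big_dep predT) //=; apply: eq_bigr => p _.
rewrite exchange_big /=; apply: eq_bigr => j _; have ltp := ltn_ord p.
(* For fixed p, the first segments inside [take p.+1 v] recombine into its own avoidance. *)
have -> : (avoid r (take (bump 0 p) v))%:R = \sum_(l < size v | (l < p.+1)%N)
    (sorted r (take l.+1 v))%:R *
    (run_weight l.+1 * (avoid r (drop l.+1 (take p.+1 v)))%:R) :> rat.
  rewrite /bump add1n avoid_rec size_takel // (big_ord_narrow ltp) /=.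
  by apply: eq_bigr => l _; rewrite take_takel.
rewrite /bump add1n mulr_suml !mulr_sumr.
by apply: eq_bigr => l _; ring.
Qed.

Lemma sorted_rev_cat r v e w :
  sorted r (rev v ++ e :: w) = path (fun x y => r y x) e v && path r e w.
Proof.
rewrite -cat_rcons -rev_cons.
have -> : path (fun x y => r y x) e v = sorted r (rev (e :: v)).
  by rewrite rev_sorted.
by rewrite rev_cons; case: (rev v) => //= x t; rewrite cat_path last_rcons.
Qed.

Lemma avoidP r w :
  reflect (forall a b c, w = a ++ b ++ c -> size b = s -> ~~ sorted r b)
          (avoid r w).
Proof.
elim: w => [|x w IHw] /=.
  apply: ReflectT => a b c /(congr1 size); rewrite !size_cat /= => size0 size_b.
  by exfalso; lia.
apply: (iffP andP) => [[lts /IHw avoidw] [|y a] b c|avoidw].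
- case: b => [|y b] /= def_w size_b; first by move: s_gt0; rewrite -size_b.
  case: def_w => <- def_w; have lt_b : (s.-1 <= size w)%N.
    by rewrite def_w size_cat -size_b leq_addr.
  have -> : b = take s.-1 w by rewrite def_w -size_b take_size_cat.
  by rewrite path_take_run // -leqNgt; lia.
- by case=> _; apply: avoidw.
split; last first.
  by apply/IHw => a b c def_w; apply: (avoidw (x :: a)); rewrite def_w.
rewrite ltnNge; apply/negP => le_s; have le_w : (s.-1 <= size w)%N.
  by rewrite -ltnS prednK // (leq_trans le_s) // run_from_leq_size.
have /negP[] := avoidw [::] (x :: take s.-1 w) (drop s.-1 w)
  (congr1 (cons x) (esym (cat_take_drop _ _)))
  (etrans (congr1 S (size_takel le_w)) (prednK s_gt0)).
by rewrite /= path_take_run // prednK.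
Qed.

Lemma avoid_rev r w : avoid r (rev w) = avoid (fun x y => r y x) w.
Proof.
apply/avoidP/avoidP => avoidw a b c def_w size_b.
  rewrite -rev_sorted; apply: (avoidw (rev c) _ (rev a)).
    by rewrite def_w !rev_cat catA.
  by rewrite size_rev.
rewrite -[b]revK rev_sorted; apply: (avoidw (rev c) _ (rev a)).
  by rewrite -[LHS]revK def_w !rev_cat catA.
by rewrite size_rev.
Qed.

(** The part before [e] is given reversed, so that on both sides the segment through [e] continues
    as a prefix; reading backwards replaces [r] by its converse. *)
Lemma avoid_split r v e w :
  (avoid r (rev v ++ e :: w))%:R
  = \sum_(i < (size v).+1) \sum_(j < (size w).+1)
     (path (fun x y => r y x) e (take i v))%:R * ((path r e (take j w))%:R *
     (run_weight (i + j).+1 *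
      ((avoid (fun x y => r y x) (drop i v))%:R * (avoid r (drop j w))%:R)))
  :> rat.
Proof.
rewrite avoid_split_take size_rev (reindex_inj rev_ord_inj) /=.
apply: eq_bigr => i _; apply: eq_bigr => j _; rewrite subSS.
have lei : (i <= size v)%N by rewrite -ltnS.
rewrite drop_rev take_rev sorted_rev_cat avoid_rev subKn //.
by rewrite -mulnb natrM -!mulrA.
Qed.

End Avoidance.

(** * Noncrossing words *)

Definition strict_total (I : eqType) (r : rel I) :=
  [/\ irreflexive r, transitive r & forall x y, x != y -> r x y || r y x].

Lemma strict_total_converse (I : eqType) (r : rel I) :
  strict_total r -> strict_total (fun x y => r y x).
Proof.
case=> rirr rtr rtot; split=> [x|y x z ryx rzy|x y nxy]; first exact: rirr.
  exact: rtr rzy ryx.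
by rewrite orbC rtot.
Qed.

(** A nonempty set has a unique element [x] related to all the others, and these form an arbitrary
    set of successors of [x]. *)
Lemma big_subset_max (R : nmodType) (I : finType) (r : rel I) (N : {set I})
    (F : {set I} -> R) : strict_total r ->
  \sum_(T : {set I} | (T \subset N) && (T != set0)) F T
  = \sum_(x in N) \sum_(T : {set I} | T \subset N :&: [set y | r x y])
      F (x |: T).
Proof.
case=> rirr rtr rtot; pose top x (T : {set I}) := [forall y in T :\ x, r x y].
transitivity (\sum_(x in N)
    \sum_(T : {set I} | [&& T \subset N, x \in T & top x T]) F T); last first.
  apply: eq_bigr => x xN.
  rewrite (reindex_onto (fun A => x |: A) (fun A => A :\ x)) /=; last first.
    by move=> A /and3P[_ xA _]; rewrite setD1K.
  apply: eq_bigl => T; rewrite subUset sub1set xN setU11 /= subsetI.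
  apply/andP/andP => [[/andP[-> /forall_inP topx] /eqP Tx]|[-> /subsetP Tx]].
    by split=> //; apply/subsetP => y; rewrite -Tx inE => /topx.
  have xT : x \notin T by apply/negP => /Tx; rewrite inE rirr.
  rewrite setU1K // eqxx; split=> //; apply/forall_inP => y.
  by rewrite setU1K // => /Tx; rewrite inE.
rewrite (exchange_big_dep (fun T : {set I} => (T \subset N) && (T != set0))) /=.
  apply: eq_bigr => T /andP[TN /set0Pn[x0 x0T]].
  (* The element with the most successors in [T] is related to all others: an element related to it
     would have strictly more. *)
  case: (arg_maxnP (fun x => #|[set y in T | r x y]|) x0T) => x xT0 xmax.
  have {xT0} xT : x \in T by [].
  have topx : top x T.
    apply/forall_inP => y; rewrite !inE => /andP[nyx yT].
    have /rtot/orP[//|ryx] : x != y by rewrite eq_sym.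
    suff /proper_card : [set z in T | r x z] \proper [set z in T | r y z].
      by rewrite ltnNge => /negP[]; apply: xmax.
    apply/properP; split; last by exists x; rewrite !inE xT ?ryx ?rirr.
    by apply/subsetP => z; rewrite !inE => /andP[-> /(rtr _ _ _ ryx)].
  rewrite (bigD1 x) /=; last by rewrite (subsetP TN) // TN xT.
  rewrite big1 ?addr0 // => y /andP[/and4P[_ _ yT /forall_inP topy] nyx].
  have := topy x; rewrite !inE eq_sym nyx xT => /(_ isT) ryx.
  move/forall_inP: topx => /(_ y); rewrite !inE nyx yT => /(_ isT) rxy.
  by have := rtr _ _ _ rxy ryx; rewrite rirr.
by move=> x T _ /and3P[-> xT _]; apply/set0Pn; exists x.
Qed.

(** * Words generated by a stack machine *)

Section Words.
Variables (I : finType) (d : I -> nat).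
Implicit Types (L w v : seq I) (N A T Z : {set I}) (x y e : I).

(** The number of letters still to be read, which is the exact fuel for [words_rec]. *)
Definition total L N := (size L + \sum_(x in N) (d x).+1)%N.

(* Noncrossing words read by a stack machine: L is the list of pending
   occurrences of the letters already read, innermost first, and N is the set of
   letters not yet read, where x is to occur d x + 1 times. *)
Fixpoint words_rec n L N : seq (seq I) :=
  if n is n'.+1 then
    (if L is e :: L' then map (cons e) (words_rec n' L' N) else [::])
    ++ [seq x :: w | x <- enum N,
          w <- words_rec n' (nseq (d x) x ++ L) (N :\ x)]
  else [:: [::]].

Definition words L N := words_rec (total L N) L N.

Lemma total_push L N x : x \in N ->
  total L N = (total (nseq (d x) x ++ L) (N :\ x)).+1.
Proof.
by move=> xN; rewrite /total (big_setD1 x) //= size_cat size_nseq; lia.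
Qed.

Lemma words_nil : words [::] set0 = [:: [::]].
Proof. by rewrite /words /total big_set0. Qed.

Lemma words_step L N : (L != [::]) || (N != set0) ->
  words L N
  = (if L is e :: L' then map (cons e) (words L' N) else [::])
    ++ [seq x :: w | x <- enum N, w <- words (nseq (d x) x ++ L) (N :\ x)].
Proof.
move=> LN; have [n def_n] : exists n, total L N = n.+1.
  case: L LN => [|e L] /= LN; last by rewrite /total /=; eexists.
  by have /set0Pn[x /total_push->] := LN; eexists.
rewrite {1}/words def_n /=; congr (_ ++ _).
  by case: L def_n {LN} => // e L [def_n]; rewrite /words -def_n.
congr flatten; apply/eq_in_map => x; rewrite mem_enum => xN.
by rewrite /words; move: (total_push L xN); rewrite def_n => -[<-].
Qed.

Lemma sum_words_step (R : nmodType) L N (g : seq I -> R) :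
  \sum_(w <- words L N) g w
  = (if L is e :: L' then \sum_(w <- words L' N) g (e :: w)
     else if N == set0 then g [::] else 0)
    + \sum_(x in N) \sum_(w <- words (nseq (d x) x ++ L) (N :\ x)) g (x :: w).
Proof.
have [LN|] := boolP ((L != [::]) || (N != set0)); last first.
  rewrite negb_or !negbK => /andP[/eqP-> /eqP->].
  by rewrite words_nil big_seq1 eqxx big_set0 addr0.
rewrite words_step // big_cat big_allpairs_dep big_enum /=; congr (_ + _).
case: L LN => [|e L] //=; last by rewrite big_map.
by move=> /negPf->; rewrite big_nil.
Qed.

(** A letter first read before the pending [e] is popped sits above [e] on the stack, so all its
    occurrences precede [e]. Hence the parts before and after [e] are complete words over disjoint
    sets of new letters. *)
Lemma sum_words_split (R : nmodType) L1 e L2 N (g : seq I -> R) :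
  \sum_(w <- words (L1 ++ e :: L2) N) g w
  = \sum_(A : {set I} | A \subset N) \sum_(v1 <- words L1 A)
      \sum_(v2 <- words L2 (N :\: A)) g (v1 ++ e :: v2).
Proof.
have [n] := ubnP (total L1 N); elim: n => // n IHn in L1 N g *.
rewrite ltnS => leLNn; rewrite sum_words_step.
pose H A v1 := \sum_(v2 <- words L2 (N :\: A)) g (v1 ++ e :: v2).
rewrite [RHS](eq_bigr (fun A =>
    (if L1 is f :: L then \sum_(v1 <- words L A) H A (f :: v1)
     else if A == set0 then H A [::] else 0)
    + \sum_(x in A) \sum_(v1 <- words (nseq (d x) x ++ L1) (A :\ x))
        H A (x :: v1))) => [|A _]; last exact: (sum_words_step L1 A (H A)).
rewrite big_split /=; congr (_ + _).
  case: L1 leLNn => [|f L1] leLNn /=; last by rewrite IHn.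
  rewrite (bigD1 set0) ?sub0set //= eqxx /H setD0.
  rewrite [X in _ + X]big1 ?addr0 // => A.
  by case/andP=> _ /negPf->.
pose F x A := \sum_(v1 <- words (nseq (d x) x ++ L1) A)
  \sum_(v2 <- words L2 ((N :\ x) :\: A)) g (x :: v1 ++ e :: v2).
rewrite (eq_bigr (fun x => \sum_(A : {set I} | A \subset N :\ x) F x A)).
  rewrite exchange_big_setD1; apply: eq_bigr => A _; apply: eq_bigr => x xA.
  by rewrite /F setD1D1.
move=> x xN; rewrite catA IHn //.
by rewrite (leq_trans _ leLNn) // (total_push L1 xN).
Qed.

Lemma pairwise_nseq_cat r x m L : irreflexive r ->
  pairwise (fun y z => ~~ r y z) L -> {in L, forall e, ~~ r x e} ->
  pairwise (fun y z => ~~ r y z) (nseq m x ++ L).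
Proof.
move=> rirr pairL xL; elim: m => //= m ->; rewrite andbT.
apply/allP=> y; rewrite mem_cat mem_nseq => /orP[/andP[_ /eqP->]|/xL//].
by rewrite rirr.
Qed.

(** [G] is the value known for smaller letter sets; it sees only the size of the stack. Pending
    letters are related to all of [Z], so a segment inside [Z] uses new letters only: it lists a
    nonempty set [T] in [r]-order and pushes [weight d T] occurrences. The induction shifts [h],
    hence its generality. *)
Lemma sum_words_first_segment (s : nat) r N Z L (G : nat -> {set I} -> rat)
    (h : nat -> rat) :
  strict_total r ->
  (forall N' L', N' \proper N -> pairwise (fun x y => ~~ r x y) L' ->
     {in L', forall x, x \notin N'} ->
     \sum_(w <- words L' N') (avoid s r w)%:R = G (size L') N') ->
  (forall z e, z \in Z -> e \in L -> r e z) ->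
  pairwise (fun x y => ~~ r x y) L -> {in L, forall x, x \notin N} ->
  \sum_(w <- words L N) \sum_(i < size w)
     (sorted r (take i.+1 w) && all [pred z | z \in Z] (take i.+1 w))%:R
     * (h i.+1 * (avoid s r (drop i.+1 w))%:R)
  = \sum_(T : {set I} | (T \subset N :&: Z) && (T != set0))
       h #|T| * G (size L + weight d T)%N (N :\: T).
Proof.
move=> rst; have [rirr rtr _] := rst.
have [n] := ubnP #|N|; elim: n => // n IHn in N Z L h *.
rewrite ltnS => leNn IHG LZ pairL LN.
(* Popping contributes nothing: a pending letter in [Z] would be related to itself. *)
rewrite sum_words_step (_ : (if _ is _ :: _ then _ else _) = 0) ?add0r;
  last first.
  case: L LZ {pairL LN} => [|e L] LZ; first by rewrite big_ord0 if_same.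
  rewrite big1 // => w _; rewrite big1 // => i _ /=.
  case eZ: (e \in Z); last by rewrite andbF mul0r.
  by have := LZ e e eZ (mem_head _ _); rewrite rirr.
rewrite (big_subset_max _ _ rst) [RHS]big_mkcond [LHS]big_mkcond.
apply: eq_bigr => x _; rewrite inE; case xN: (x \in N) => //=.
case: ifP => xZ; last first.
  rewrite big1 // => w _; rewrite big1 // => i _ /=.
  by rewrite andbF mul0r.
have properN N' : N' \subset N :\ x -> N' \proper N.
  by move=> N'N; apply: sub_proper_trans N'N (properD1 xN).
have xL e : e \in L -> ~~ r x e.
  by move=> /(LZ x _ xZ) rex; apply/negP => /(rtr _ _ _ rex); rewrite rirr.
(* The segment goes on with letters of [Z] to which [x] is related, so the condition on pending
   letters persists. *)
pose L' := nseq (d x) x ++ L; pose Z' := Z :&: [set y | r x y].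
have pairL' : pairwise (fun x y => ~~ r x y) L' by apply: pairwise_nseq_cat.
have L'N : {in L', forall y, y \notin N :\ x}.
  move=> y; rewrite mem_cat mem_nseq !inE => /orP[/andP[_ /eqP->]|yL].
    by rewrite eqxx.
  by rewrite (negPf (LN y yL)) andbF.
have L'Z z e : z \in Z' -> e \in L' -> r e z.
  rewrite !inE mem_cat mem_nseq => /andP[zZ rxz].
  by case/orP=> [/andP[_ /eqP->]//|]; apply: LZ.
have lt_n : (#|N :\ x| < n)%N.
  by rewrite (leq_trans _ leNn) // (cardsD1 x N) xN.
have := IHn (N :\ x) Z' L' (fun l => h l.+1) lt_n _ L'Z pairL' L'N.
have IHG' N'' L'' : N'' \proper N :\ x -> pairwise (fun x y => ~~ r x y) L'' ->
   {in L'', forall y, y \notin N''} ->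
   \sum_(w <- words L'' N'') (avoid s r w)%:R = G (size L'') N''.
  by move=> /proper_sub N''N; apply: IHG; apply: properN.
move=> /(_ IHG') IH.
have NZ : N :&: Z :&: [set y | r x y] = (N :\ x) :&: Z'.
  apply/setP=> y; rewrite !inE -andbA; case: eqP => // ->.
  by rewrite rirr !andbF.
rewrite NZ [RHS](bigD1 set0) ?sub0set //=.
(* Either [x] is the whole segment, or the rest is a segment for the shifted [h]. *)
transitivity (h 1%N * G (size L') (N :\ x) +
   \sum_(w <- words L' (N :\ x)) \sum_(i < size w)
     (sorted r (take i.+1 w) && all [pred z | z \in Z'] (take i.+1 w))%:R
     * (h i.+2 * (avoid s r (drop i.+1 w))%:R)).
  rewrite -(IHG (N :\ x) L') ?properN // mulr_sumr -big_split /=.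
  apply: eq_bigr => w _; rewrite big_ord_recl take0 drop0 mul1r.
  congr (_ + _); apply: eq_bigr => i _; congr (_%:R * _).
  rewrite path_sortedE // -andbA andbCA; congr (_ && _).
  rewrite -all_predI; apply: eq_all => y /=.
  by rewrite !inE andbC.
have szL' : size L' = (d x + size L)%N by rewrite size_cat size_nseq.
rewrite IH; congr (_ + _).
  rewrite setU0 cards1 /weight big_set1 szL' [(size L + _)%N]addnC.
  by [].
apply: eq_bigr => T /andP[/subsetP TN _].
have xT : x \notin T by apply/negP => /TN; rewrite !inE eqxx.
rewrite cardsU1 xT /weight big_setU1 //= szL' setDDl; congr (_ * G _ _).
by rewrite [(d x + size L)%N]addnC addnA.
Qed.

End Words.

Definition noncrossing (T : eqType) (w : seq T) :=
  forall x y, x != y -> ~~ subseq [:: x; y; x; y] w.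

Lemma noncrossing_rev (T : eqType) (w : seq T) :
  noncrossing (rev w) <-> noncrossing w.
Proof.
suff rev_nc (v : seq T) : noncrossing v -> noncrossing (rev v).
  by split=> /rev_nc; rewrite ?revK.
by move=> ncv x y nxy; rewrite -subseq_rev revK ncv // eq_sym.
Qed.

Lemma subseq_cons_neq (T : eqType) (x y : T) s w :
  x != y -> subseq (x :: s) (y :: w) = subseq (x :: s) w.
Proof. by move=> /negPf /= ->. Qed.

Lemma filter_separate (T : eqType) (x : T) (w : seq T) :
  (forall e, e != x -> ~~ subseq [:: e; x] w) ->
  w = nseq (count_mem x w) x ++ filter (predC1 x) w.
Proof.
elim: w => //= y w IHw sepw; have sepw' e : e != x -> ~~ subseq [:: e; x] w.
  move=> /sepw; apply: contra => /= sub_w; case: eqP => // _.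
  exact: subseq_trans (subseq_cons _ _) sub_w.
have [->|nyx] := eqVneq y x; first by rewrite /= -IHw.
have := sepw y nyx; rewrite /= eqxx sub1seq => xw.
have filterE : filter (predC1 x) w = w.
  by apply/all_filterP/allP => z zw; apply: contraNneq xw => <-.
by rewrite (count_memPn xw) filterE.
Qed.

Lemma subseq_nseq_cat (T : eqType) (x e : T) m s w :
  e != x -> subseq (e :: s) (nseq m x ++ w) = subseq (e :: s) w.
Proof.
by move=> nex; elim: m => // m <-; rewrite [nseq _.+1 x ++ w]/= subseq_cons_neq.
Qed.

Lemma big_subsetU (R : nmodType) (I : finType) (X Y : {set I})
    (F : {set I} -> {set I} -> R) : [disjoint X & Y] ->
  \sum_(B : {set I} | B \subset X) \sum_(C : {set I} | C \subset Y) F B C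
  = \sum_(T : {set I} | T \subset X :|: Y) F (T :&: X) (T :&: Y).
Proof.
move=> disXY; rewrite pair_big /=.
rewrite (reindex_onto (fun T => (T :&: X, T :&: Y)) (fun p => p.1 :|: p.2)) /=.
  apply: eq_bigl => T; rewrite !subsetIr -setIUr /=.
  by apply/eqP/idP => [|/setIidPl //]; apply: (introT setIidPl).
move=> [B C] /= /andP[/setIidPl BX /setIidPl CY].
have XY0 := disjoint_setI0 disXY.
rewrite !setIUl BX CY -[in C :&: X]CY -[in B :&: Y]BX.
by rewrite -!setIA [Y :&: X]setIC XY0 !setI0 setU0 set0U.
Qed.

(** * The stack machine produces exactly the noncrossing words *)

Section WordsNoncrossing.
Variables (I : finType) (d : I -> nat).
Implicit Types (L w : seq I) (N : {set I}) (x y e : I).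

Lemma mem_words_nil L N :
  ([::] \in words d L N) = (L == [::]) && (N == set0).
Proof.
have [/andP[/eqP-> /eqP->]|] := boolP ((L == [::]) && (N == set0)).
  by rewrite words_nil.
rewrite negb_and => LN; rewrite words_step // mem_cat; apply/norP; split.
  by case: L {LN} => // e L; apply/mapP => -[].
by apply/allpairsPdep => -[x [w []]].
Qed.

Lemma mem_words_cons L N x w :
  (x :: w \in words d L N)
  = (if L is e :: L' then (x == e) && (w \in words d L' N) else false)
    || (x \in N) && (w \in words d (nseq (d x) x ++ L) (N :\ x)).
Proof.
have [LN|] := boolP ((L != [::]) || (N != set0)); last first.
  rewrite negb_or !negbK => /andP[/eqP-> /eqP->].
  by rewrite words_nil !inE.
rewrite words_step // mem_cat; congr (_ || _).
  case: L {LN} => [|e L]; first by rewrite in_nil.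
  apply/mapP/andP => [[v vL [-> ->]]|[/eqP-> wL]]; first by rewrite eqxx.
  by exists w.
apply/allpairsPdep/andP => [[y [v [yN vL [-> ->]]]]|[xN wL]].
  by rewrite -mem_enum.
by exists x, w; rewrite mem_enum.
Qed.

Lemma words_uniq L N : {in L, forall x, x \notin N} -> uniq (words d L N).
Proof.
have [n] := ubnP (total d L N); elim: n => // n IHn in L N *.
rewrite ltnS => leLNn LN.
have [LN0|] := boolP ((L != [::]) || (N != set0)); last first.
  by rewrite negb_or !negbK => /andP[/eqP-> /eqP->]; rewrite words_nil.
rewrite words_step // cat_uniq; apply/and3P; split.
- case: L LN leLNn {LN0} => // e L LN leLNn.
  rewrite map_inj_uniq => [|v w [] //]; apply: IHn => // x xL.
  by apply: LN; rewrite inE xL orbT.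
- apply/hasPn => v /allpairsPdep[x [w [xN _ ->]]].
  case: L LN {leLNn LN0} => // e L LN; apply/mapP => -[u _ [xe _]].
  by have := LN e (mem_head _ _); rewrite -xe -mem_enum xN.
apply: allpairs_uniq_dep; rewrite ?enum_uniq //; last first.
  by move=> [x v] [y w] _ _ /= [-> ->].
move=> x; rewrite mem_enum => xN; apply: IHn.
  by rewrite -ltnS -total_push.
move=> y; rewrite mem_cat mem_nseq !inE => /orP[/andP[_ /eqP->]|/LN/negPf->].
  by rewrite eqxx.
by rewrite andbF.
Qed.

(** The admissible continuations from the state [L], [N]. Pending letters have occurred already:
    they must return in stack order, and [y e y] around a pending [e] would complete a crossing
    [e y e y]. *)
Definition completes L N w :=
  [/\ forall x, count_mem x w = (count_mem x L + (x \in N) * (d x).+1)%N,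
      noncrossing w,
      filter [in L] w = L
    & forall e y, e \in L -> y != e -> ~~ subseq [:: y; e; y] w].

(** No pending letter may come between two occurrences of the new [x], so its other [d x] copies go
    on top of the stack. *)
Lemma completes_push L N x w : x \in N -> {in L, forall y, y \notin N} ->
  completes L N (x :: w) <-> completes (nseq (d x) x ++ L) (N :\ x) w.
Proof.
move=> xN LN; have xL : x \notin L by apply/negP => /LN; rewrite xN.
have countE : (forall y, count_mem y (x :: w)
      = (count_mem y L + (y \in N) * (d y).+1)%N) <->
    (forall y, count_mem y w = (count_mem y (nseq (d x) x ++ L)
       + (y \in N :\ x) * (d y).+1)%N).
  split=> cw y; have := cw y; rewrite /= count_cat count_nseq !inE /= eq_sym;
    by have [->|] := eqVneq y x; rewrite ?xN /= ?(count_memPn xL); lia.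
split=> -[cw ncw fw sepw].
  have cx : count_mem x w = d x.
    by have := cw x; rewrite /= eqxx xN (count_memPn xL); lia.
  split; first exact/countE.
  - move=> y z nyz; apply: contra (ncw y z nyz) => sub_w.
    exact: subseq_trans sub_w (subseq_cons _ _).
  - have memE : {in w, [in nseq (d x) x ++ L] =1 [in x :: L]}.
      move=> y yw; rewrite /= mem_cat mem_nseq inE.
      case: eqP => [yx|]; last by rewrite andbF.
      by rewrite andbT -cx -has_count has_pred1 -yx yw.
    rewrite (eq_in_filter memE) [LHS](@filter_separate _ x).
      rewrite count_filter -filter_predI; congr (nseq _ x ++ _).
        rewrite -[RHS]cx; apply: eq_count => y /=.
        by rewrite inE; case: eqP.
      rewrite -[RHS]fw /= (negPf xL); apply: eq_filter => y /=.
      by rewrite inE; case: eqP => // ->; rewrite (negPf xL).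
    move=> e nex; apply/negP => sub_w.
    have : e \in filter [in x :: L] w by rewrite (mem_subseq sub_w) ?mem_head.
    rewrite mem_filter /= inE (negPf nex) => /andP[eL _].
    have nxe : x != e by rewrite eq_sym.
    have /negP[] := sepw e x eL nxe.
    by rewrite /= eqxx (subseq_trans sub_w) // filter_subseq.
  - move=> e y; rewrite mem_cat mem_nseq => /orP[/andP[_ /eqP->]|eL] nye.
      apply: contra (ncw x y _); last by rewrite eq_sym.
      by rewrite /= eqxx.
    apply: contra (sepw e y eL nye) => sub_w.
    exact: subseq_trans sub_w (subseq_cons _ _).
have cx : count_mem x w = d x.
  rewrite cw count_cat count_nseq /= eqxx (count_memPn xL) !inE eqxx /=; lia.
have xw_stack : x \in w -> x \in nseq (d x) x ++ L.
  by rewrite mem_cat mem_nseq eqxx andbT -cx -has_count has_pred1 => ->.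
split; first exact/countE.
- move=> y z nyz; have [yx|nyx] := eqVneq y x; last first.
    by rewrite subseq_cons_neq // ncw.
  move: nyz; rewrite {}yx eq_sym => nzx.
  rewrite /= eqxx; apply/negP => sub_w.
  have xw : x \in w by rewrite (mem_subseq sub_w) // !inE eqxx orbT.
  by have /negP[] := sepw x z (xw_stack xw) nzx.
- rewrite /= (negPf xL) -[RHS](_ : filter [in L] (nseq (d x) x ++ L) = L).
    rewrite -fw -filter_predI; apply: eq_filter => y /=.
    by rewrite mem_cat andb_orr; case: (y \in L); rewrite ?orbT.
  rewrite filter_cat [X in X ++ _](_ : _ = [::]).
    by apply/all_filterP/allP.
  by apply/eqP; rewrite -size_eq0 size_filter count_nseq /= (negPf xL).
move=> e y eL nye; have eS : e \in nseq (d x) x ++ L by rewrite mem_cat eL orbT.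
have [->|nyx] := eqVneq y x; last by rewrite subseq_cons_neq // sepw.
rewrite /= eqxx; apply/negP => sub_w.
have xw : x \in w by rewrite (mem_subseq sub_w) // !inE eqxx orbT.
have : subseq [:: e; x] (nseq (d x) x ++ L).
  by rewrite -fw subseq_filter /= eS xw_stack.
have nex : e != x by apply: contraNneq xL => <-.
rewrite subseq_nseq_cat //.
by move/mem_subseq/(_ x); rewrite !inE eqxx orbT (negPf xL) => /(_ isT).
Qed.

(** Equal letters are contiguous on the stack. This excludes [x e x] with [e] pending when a further
    [x] remains after the pop. *)
Lemma completes_pop L N x w :
  {in x :: L, forall y, y \notin N} ->
  (forall e y, y != e -> ~~ subseq [:: y; e; y] (x :: L)) ->
  completes (x :: L) N (x :: w) <-> completes L N w.
Proof.
move=> LN stackL; have xN := LN x (mem_head _ _).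
have countE : (forall y, count_mem y (x :: w)
      = (count_mem y (x :: L) + (y \in N) * (d y).+1)%N) <->
    (forall y, count_mem y w = (count_mem y L + (y \in N) * (d y).+1)%N).
  by split=> cw y; have := cw y; rewrite /=; lia.
split=> -[cw ncw fw sepw].
  move: fw; rewrite /= mem_head => -[fw].
  split; first exact/countE.
  - move=> y z nyz; apply: contra (ncw y z nyz) => sub_w.
    exact: subseq_trans sub_w (subseq_cons _ _).
  - transitivity (filter [in L] (filter [in x :: L] w)).
      rewrite -filter_predI; apply: eq_filter => y /=.
      by rewrite inE andb_orr andbb; case: (y \in L); rewrite ?orbT ?andbF.
    by rewrite fw; apply/all_filterP/allP.
  - move=> e y eL nye; apply: contra (sepw e y _ nye) => [sub_w|].
      exact: subseq_trans sub_w (subseq_cons _ _).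
    by rewrite inE eL orbT.
have xL_of : x \in w -> x \in L.
  rewrite -has_pred1 has_count cw (negPf xN) addn0 => cx.
  by rewrite -has_pred1 has_count.
split; first exact/countE.
- move=> y z nyz; have [yx|nyx] := eqVneq y x; last first.
    by rewrite subseq_cons_neq // ncw.
  move: nyz; rewrite {}yx eq_sym => nzx.
  rewrite /= eqxx; apply/negP => sub_w.
  have xw : x \in w by rewrite (mem_subseq sub_w) // !inE eqxx orbT.
  by have /negP[] := sepw x z (xL_of xw) nzx.
- rewrite /= mem_head -[X in _ = _ :: X]fw; congr (_ :: _).
  apply: eq_in_filter => y yw; rewrite /= inE; case: eqP => //= yx.
  by rewrite yx xL_of // -yx.
move=> e y eL nye; have [yx|nyx] := eqVneq y x; last first.
  rewrite subseq_cons_neq //; apply/negP => sub_w.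
  have ew : e \in w by rewrite (mem_subseq sub_w) // !inE eqxx orbT.
  suff eL' : e \in L by have /negP[] := sepw e y eL' nye.
  by move: eL; rewrite inE => /predU1P[ex|//]; rewrite ex xL_of -?ex.
move: nye; rewrite {}yx => nxe.
rewrite /= eqxx; apply/negP => sub_w.
have xw : x \in w by rewrite (mem_subseq sub_w) // !inE eqxx orbT.
have {}eL : e \in L by move: eL; rewrite inE eq_sym (negPf nxe).
have /negP[] := stackL e x nxe; rewrite /= eqxx -fw subseq_filter /=.
by rewrite eL xL_of.
Qed.

Lemma mem_words_completes L N w :
  {in L, forall y, y \notin N} ->
  (forall e y, y != e -> ~~ subseq [:: y; e; y] L) ->
  w \in words d L N <-> completes L N w.
Proof.
elim: w L N => [|x w IHw] L N LN stackL.
  rewrite mem_words_nil; split=> [/andP[/eqP-> /eqP->]|[cw _ <- _]].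
    by split=> // x; rewrite inE.
  rewrite eqxx; apply/eqP/setP => x; have := cw x; rewrite /= inE.
  by case: (x \in N); rewrite // mul1n addnS.
(* A letter of [N] is not on the stack and can only be pushed; any other letter can only be
   popped. *)
rewrite mem_words_cons; case xN: (x \in N).
  have xL : x \notin L by apply/negP => /LN; rewrite xN.
  have -> : (if L is e :: L' then (x == e) && (w \in words d L' N) else false)
      = false.
    by case: L xL {LN stackL} => //= e L; rewrite inE => /norP[/negPf->].
  rewrite completes_push // -IHw //= => [y|e y nye].
    rewrite mem_cat mem_nseq !inE => /orP[/andP[_ /eqP->]|/LN/negPf->].
      by rewrite eqxx.
    by rewrite andbF.
  elim: (d x) => [|m IHm]; first exact: stackL.
  have [yx|nyx] := eqVneq y x; last by rewrite subseq_cons_neq.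
  rewrite /= yx eqxx subseq_nseq_cat -?yx 1?eq_sym //.
  by apply: contra xL => /mem_subseq/(_ x); rewrite -yx !inE eqxx orbT => ->.
rewrite orbF; split=> [|compl].
  case: L LN stackL => // e L LN stackL /andP[/eqP xe].
  rewrite {}xe in LN stackL *.
  move=> wL; apply/completes_pop => //; apply/IHw => //.
    by move=> y yL; apply: LN; rewrite inE yL orbT.
  move=> f y nyf; apply: contra (stackL f y nyf) => sub_L.
  exact: subseq_trans sub_L (subseq_cons _ _).
have [cw _ fw _] := compl.
have xL : x \in L.
  by have := cw x; rewrite /= eqxx xN addn0 -has_pred1 has_count => <-.
case: L LN stackL compl {cw} fw xL => // e L LN stackL compl + xL.
rewrite /= xL => -[xe _]; rewrite -{}xe in LN stackL compl *.
rewrite eqxx; have wL := (completes_pop w LN stackL).1 compl; apply/IHw => //.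
  by move=> y yL; apply: LN; rewrite inE yL orbT.
move=> f y nyf; apply: contra (stackL f y nyf) => sub_L.
exact: subseq_trans sub_L (subseq_cons _ _).
Qed.

Lemma mem_words N w :
  w \in words d [::] N <->
  (forall x, count_mem x w = (x \in N) * (d x).+1)%N /\ noncrossing w.
Proof.
rewrite mem_words_completes //; split=> [[]|[cw ncw]] //; split=> //.
by rewrite -[RHS](filter_pred0 w); apply: eq_filter.
Qed.

(** The noncrossing condition is symmetric under reversal, although the stack machine reads from the
    left. *)
Lemma sum_words_rev (R : nmodType) N (g : seq I -> R) :
  \sum_(w <- words d [::] N) g (rev w) = \sum_(w <- words d [::] N) g w.
Proof.
rewrite -(big_map rev xpredT); apply: perm_big; apply: uniq_perm.
- by rewrite map_inj_uniq ?words_uniq //; apply: can_inj revK.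
- exact: words_uniq.
move=> w; rewrite -{1}[w]revK (mem_map (can_inj revK)).
suff rev_words v : v \in words d [::] N -> rev v \in words d [::] N.
  by apply/idP/idP => /rev_words; rewrite ?revK.
move=> /mem_words[cw ncw]; apply/mem_words; split=> [x|].
  by rewrite count_rev.
exact/noncrossing_rev.
Qed.

End WordsNoncrossing.

(** * Counting avoiding noncrossing words *)

Section AvoidingWords.
Variables (s : nat) (I : finType) (d : I -> nat).
Hypothesis s_gt1 : (1 < s)%N.
Implicit Types (r : rel I) (L : seq I) (A N T : {set I}) (e x y : I).

(* These are the series W, u and phi of the introduction. *)
Definition run_egf : {fps rat} := egf (run_weight s).
Definition seg_egf : {fps rat} := (1 - run_egf)^-1.
Definition link_egf : {fps rat} := seg_egf * fps_deriv run_egf.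

Lemma run_weight0 : run_weight s 0 = 0.
Proof. by rewrite /run_weight mod0n subrr. Qed.

Lemma run_egf_unit : (1 - run_egf) \is a GRing.unit.
Proof.
by rewrite fps_unitE fps_coefB fps_coef1 /= run_weight0 mul0r subr0 unitr1.
Qed.

Lemma seg_egfE : seg_egf = 1 + run_egf * seg_egf.
Proof.
apply/eqP; rewrite -subr_eq -{1}[seg_egf]mul1r -mulrBl.
by rewrite mulrV ?run_egf_unit.
Qed.

Lemma seg_egf0 : seg_egf`[0] = 1.
Proof.
by rewrite seg_egfE fps_coefD fps_coef1 fps_coef0M /= run_weight0 !mul0r addr0.
Qed.

Lemma deriv_run_egf : fps_deriv run_egf = egf (fun l => run_weight s l.+1).
Proof.
apply/fpsP=> l; rewrite /= factS natrM invfM mulrCA mulrC -mulrnAl.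
by rewrite -[X in X / _ = _]mulr_natr mulfK // pnatr_eq0.
Qed.

Lemma deriv_seg_egf : fps_deriv seg_egf = link_egf * seg_egf.
Proof.
have /(congr1 (@fps_deriv _)) := mulrV run_egf_unit.
rewrite fps_derivM fps_deriv1 fps_derivD fps_deriv1 fps_derivN add0r mulNr.
move/eqP; rewrite addrC subr_eq0 => /eqP derivE.
apply: (mulrI run_egf_unit); rewrite derivE /link_egf.
rewrite -[_ * _ * _ in RHS]mulrA [RHS]mulrA /seg_egf.
by rewrite mulrV ?run_egf_unit // mul1r.
Qed.

(** This treats the part of the segment through [e] that follows [e]. It may be empty, which is the
    term [T = set0] and needs the value on all of [N]. A pending letter equals [e] or is related to
    it, hence is related to every letter that may continue. *)
Lemma sum_words_first_segment_below r e N L (G : nat -> {set I} -> rat)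
    (h : nat -> rat) :
  strict_total r ->
  (forall N' L', N' \proper N -> pairwise (fun x y => ~~ r x y) L' ->
     {in L', forall x, x \notin N'} ->
     \sum_(w <- words d L' N') (avoid s r w)%:R = G (size L') N') ->
  \sum_(w <- words d L N) (avoid s r w)%:R = G (size L) N ->
  pairwise (fun x y => ~~ r x y) (e :: L) -> {in L, forall x, x \notin N} ->
  \sum_(w <- words d L N) \sum_(i < (size w).+1)
     (path r e (take i w))%:R * (h i * (avoid s r (drop i w))%:R)
  = \sum_(T : {set I} | T \subset N :&: [set y | r e y])
       h #|T| * G (size L + weight d T)%N (N :\: T).
Proof.
move=> rst IHG GN /= /andP[/allP eL pairL] LN; have [rirr rtr rtot] := rst.
rewrite [RHS](bigD1 set0) ?sub0set //= cards0 weight_set0 addn0 setD0 -GN.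
rewrite -(sum_words_first_segment (s := s) (r := r) (L := L)) //.
  rewrite mulr_sumr -big_split /=; apply: eq_bigr => w _.
  rewrite big_ord_recl take0 drop0 mul1r; congr (_ + _).
  apply: eq_bigr => i _; congr (_%:R * _).
  rewrite path_sortedE // andbC; congr (_ && _).
  by apply: eq_all => y; rewrite /= inE.
move=> z f; rewrite inE => rez fL; have [<-//|nef] := eqVneq e f.
by have := rtot e f nef; rewrite (negPf (eL f fL)) => /= rfe; apply: rtr rez.
Qed.

(** Double induction on the letters and the stack, over all orders because the converse is needed
    too. On the empty stack, the first segment gives u = 1 + W u. On [e :: L], the segment through
    [e] contributes W', and the words before and after it contribute u and phi^(size L) u. *)
Theorem sum_words_avoid r N L :
  strict_total r -> pairwise (fun x y => ~~ r x y) L ->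
  {in L, forall x, x \notin N} ->
  \sum_(w <- words d L N) (avoid s r w)%:R
  = lagrange d link_egf (link_egf ^+ size L * seg_egf) N.
Proof.
pose G m N := lagrange d link_egf (link_egf ^+ m * seg_egf) N.
have [n] := ubnP #|N|; elim: n => // n IHn in r N L *.
rewrite ltnS => leNn.
have IHN r' N0 : N0 \subset N -> strict_total r' ->
    forall N' L', N' \proper N0 -> pairwise (fun x y => ~~ r' x y) L' ->
    {in L', forall x, x \notin N'} ->
    \sum_(w <- words d L' N') (avoid s r' w)%:R = G (size L') N'.
  move=> N0N rst' N' L' /proper_sub_trans/(_ N0N)/proper_card ltN'.
  apply: IHn => //.
  exact: leq_trans ltN' leNn.
have base r' : strict_total r' ->
    \sum_(w <- words d [::] N) (avoid s r' w)%:R = G 0%N N.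
  move=> rst'; rewrite /G expr0 mul1r; have [->|N0] := eqVneq N set0.
    by rewrite words_nil big_seq1 lagrange_set0 seg_egf0.
  rewrite seg_egfE lagrangeD (lagrangeC _ _ 1) (negPf N0) mulr0n add0r.
  rewrite lagrange_egfM [RHS](bigD1 set0) ?sub0set //= cards0 run_weight0.
  rewrite mul0r add0r.
  have := sum_words_first_segment (Z := setT) (run_weight s) rst'
    (IHN r' N (subxx N) rst') (L := [::]).
  rewrite setIT => <- //.
  rewrite big_seq [RHS]big_seq; apply: eq_bigr => w wN.
  rewrite avoid_rec //; last first.
    case: w wN => //; by rewrite mem_words_nil (negPf N0).
  apply: eq_bigr => i _; congr (_%:R * _).
  rewrite (eq_all (a2 := predT)) ?all_predT ?andbT // => y /=.
  by rewrite inE.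
move=> rst; have rst' := strict_total_converse rst; have [rirr rtr rtot] := rst.
elim: L => [|e L IHL] pairL LN; first exact: base.
(* Cut at the first pending occurrence e: the part before e is read backwards, so
   that its last segment comes first and decreases for the converse order. *)
pose r' : rel I := fun x y => r y x.
have LN' : {in L, forall x, x \notin N}.
  by move=> x xL; apply: LN; rewrite inE xL orbT.
have pairL' : pairwise (fun x y => ~~ r x y) L by case/andP: pairL.
have {IHL} GL A : A \subset N ->
    \sum_(w <- words d L A) (avoid s r w)%:R = G (size L) A.
  rewrite subEproper => /predU1P[->|AN]; first exact: IHL.
  apply: (IHN r N (subxx N) rst _ _ AN pairL') => x /LN'; apply: contra.
  exact: (subsetP (proper_sub AN)).
have G0 A : A \subset N ->
    \sum_(w <- words d [::] A) (avoid s r' w)%:R = G 0%N A.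
  rewrite subEproper => /predU1P[->|AN]; first exact: base.
  exact: (IHN r' N (subxx N) rst' _ [::] AN).
pose up := [set y | r' e y]; pose dn := [set y | r e y].
(* [A] holds the new letters read before [e]; the segment takes [B] from it before [e], and [C] from
   the others after [e]. *)
transitivity (\sum_(A : {set I} | A \subset N)
   \sum_(B : {set I} | B \subset A :&: up)
   \sum_(C : {set I} | C \subset (N :\: A) :&: dn)
     run_weight s (#|B| + #|C|).+1 *
     (G (weight d B) (A :\: B) * G (size L + weight d C)%N (N :\: A :\: C))).
  rewrite (sum_words_split d [::] e L N); apply: eq_bigr => A AN.
  pose h i := \sum_(C : {set I} | C \subset (N :\: A) :&: dn)
    run_weight s (i + #|C|).+1 * G (size L + weight d C)%N (N :\: A :\: C).
  transitivity (\sum_(v <- words d [::] A) \sum_(i < (size v).+1)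
      (path r' e (take i v))%:R * (h i * (avoid s r' (drop i v))%:R)).
    rewrite -sum_words_rev; apply: eq_bigr => v _.
    under eq_bigr => v2 _ do rewrite avoid_split //.
    rewrite exchange_big; apply: eq_bigr => i _ /=.
    have NA : N :\: A \subset N by apply: subsetDl.
    have pairLe : pairwise (fun x y => ~~ r x y) (e :: L) by [].
    have LNA : {in L, forall x, x \notin N :\: A}.
      by move=> x /LN' /negPf xN; rewrite inE xN andbF.
    have := sum_words_first_segment_below (fun j => run_weight s (i + j).+1) rst
      (IHN r _ NA rst) (GL _ NA) pairLe LNA.
    rewrite -/dn -/(h i) => <-.
    rewrite mulr_suml mulr_sumr; apply: eq_bigr => v2 _.
    by rewrite mulr_suml mulr_sumr; apply: eq_bigr => j _; rewrite /r'; ring.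
  rewrite (sum_words_first_segment_below (L := [::]) h rst'
    (IHN r' A AN rst')) //.
    by apply: eq_bigr => B _; rewrite mulr_suml; apply: eq_bigr => C _; ring.
  exact: G0.
(* Each letter of [N] lies on exactly one side of [e], so the union [T] of [B] and [C] determines
   both. *)
have eN : e \notin N by apply: LN; rewrite mem_head.
have updn x : x \in N -> (x \in dn) = (x \notin up).
  move=> xN; rewrite !inE /r'; have nex : e != x by apply: contraNneq eN => ->.
  case/orP: (rtot e x nex) => [rex|rxe].
    by rewrite rex; apply/esym/negP => /(rtr _ _ _ rex); rewrite rirr.
  by rewrite rxe; apply/negP => /(rtr _ _ _ rxe); rewrite rirr.
pose P A T := [&& T \subset N, T :&: up \subset A & T :&: dn \subset N :\: A].
pose F T A := run_weight s #|T|.+1 * (G (weight d (T :&: up)) (A :\: (T :&: up))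
   * G (size L + weight d (T :&: dn))%N (N :\: A :\: (T :&: dn))).
have splitT T : T \subset N -> T = (T :&: up) :|: (T :&: dn).
  move=> /subsetP TN; apply/setP=> x; rewrite in_setU !in_setI.
  by case xT: (x \in T); rewrite //= updn ?TN // orbN.
have disT A : [disjoint A :&: up & (N :\: A) :&: dn].
  rewrite -setI_eq0; apply/eqP/setP=> x; rewrite !inE.
  by case: (x \in A); rewrite //= !andbF.
have PE A T : A \subset N ->
    (T \subset (A :&: up) :|: ((N :\: A) :&: dn)) = P A T.
  move=> AN; apply/idP/and3P => [/subsetP TX|[TN upA dnA]]; last first.
    by rewrite (splitT T TN); apply: setUSS; rewrite subsetI subsetIr andbT.
  have TN : T \subset N.
    apply/subsetP => x /TX; rewrite !inE.
    by case/orP=> [/andP[/(subsetP AN)]|/andP[/andP[_ ->]]].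
  split=> //; apply/subsetP => x; rewrite in_setI => /andP[xT xud].
    have := TX x xT; rewrite in_setU !in_setI xud updn ?(subsetP TN) // xud.
    by rewrite andbT andbF orbF.
  have xN := subsetP TN x xT.
  have := TX x xT; rewrite in_setU !in_setI xud; rewrite updn // in xud.
  by rewrite (negPf xud) andbF andbT.
have PIup A T : P A T -> T :&: (A :&: up) = T :&: up.
  by case/and3P=> _ upA _; rewrite setICA setIC; apply/setIidPl.
have PIdn A T : P A T -> T :&: ((N :\: A) :&: dn) = T :&: dn.
  by case/and3P=> _ _ dnA; rewrite setICA setIC; apply/setIidPl.
have disT2 T : T \subset N -> [disjoint T :&: up & T :&: dn].
  move=> TN; rewrite -setI_eq0; apply/eqP/setP=> x; rewrite !in_setI in_set0.
  by case xT: (x \in T); rewrite //= updn ?(subsetP TN) // andbN.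
have cardT T : T \subset N -> (#|T :&: up| + #|T :&: dn|)%N = #|T|.
  move=> TN; rewrite -cardsUI (disjoint_setI0 (disT2 T TN)).
  by rewrite -splitT // cards0 addn0.
transitivity (\sum_(A : {set I} | A \subset N) \sum_(T | P A T) F T A).
  apply: eq_bigr => A AN; rewrite big_subsetU ?disT //.
  apply: eq_big => [T|T]; rewrite PE // => PAT.
  by rewrite PIup // PIdn // cardT //; case/and3P: PAT.
rewrite (exchange_big_dep (fun T : {set I} => T \subset N)) /=; last first.
  by move=> A T _ /and3P[].
(* One factor accounts for the segment and one for each side of it. *)
have -> : link_egf ^+ size (e :: L) * seg_egf
    = fps_deriv run_egf * (seg_egf * (link_egf ^+ size L * seg_egf)).
  by rewrite /= exprS /link_egf; ring.
rewrite deriv_run_egf lagrange_egfM; apply: eq_bigr => T TN.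
rewrite -mulr_sumr; congr (_ * _).
have wT : weight d T = (weight d (T :&: up) + weight d (T :&: dn))%N.
  rewrite /weight (big_setID up) /=; congr (_ + _)%N; apply: eq_bigl => x.
  rewrite in_setD in_setI andbC; case xT: (x \in T) => //=.
  by rewrite updn // (subsetP TN).
rewrite wT exprD.
have -> : link_egf ^+ weight d (T :&: up) * link_egf ^+ weight d (T :&: dn)
    * (seg_egf * (link_egf ^+ size L * seg_egf))
  = (link_egf ^+ weight d (T :&: up) * seg_egf)
    * (link_egf ^+ (size L + weight d (T :&: dn)) * seg_egf).
  by rewrite exprD; ring.
(* For fixed [T], the possible [A] are [T :&: up] joined with any set of letters of [N] outside [T],
   which is the convolution of [lagrangeM]. *)
rewrite lagrangeM (reindex_onto (fun A => (T :&: up) :|: A)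
  (fun A => A :\: (T :&: up))) /=; last first.
  move=> A /and3P[_ _ /andP[upA _]]; apply/setP=> x.
  by rewrite in_setU in_setD; case: (boolP (x \in _)) => //= /(subsetP upA) ->.
have condE A : [&& T :&: up :|: A \subset N, P (T :&: up :|: A) T
    & (T :&: up :|: A) :\: (T :&: up) == A] = (A \subset N :\: T).
  apply/and3P/idP => [[hN /and3P[_ _ dnA] /eqP hA]|].
    apply/subsetP => x xA.
    have xh : x \in T :&: up :|: A by rewrite inE xA orbT.
    rewrite in_setD (subsetP hN) // andbT; apply/negP => xT.
    move: xA; rewrite -{1}hA in_setD in_setI xT /= => /andP[xup _].
    have := subsetP dnA x; rewrite in_setI xT updn ?(subsetP TN) // xup.
    by rewrite in_setD xh; move/(_ isT).
  rewrite subsetD => /andP[AN disAT].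
  have notT x : x \in A -> x \notin T by move=> xA; rewrite (disjointFr disAT).
  split.
  - by rewrite subUset AN andbT (subset_trans (subsetIl _ _)).
  - rewrite /P TN subsetUl /=; apply/subsetP => x.
    rewrite in_setI => /andP[xT xdn].
    have xN := subsetP TN x xT; rewrite in_setD xN andbT in_setU in_setI.
    rewrite -[x \in up]negbK -updn // xdn andbF /=.
    by apply: contraL xT => /notT.
  apply/eqP/setP => x; rewrite in_setD in_setU in_setI.
  case: (boolP (x \in A)) => [/notT/negPf->|_] //=.
  by rewrite orbF andNb.
apply: eq_big => [A|A]; first by rewrite -condE andbA.
rewrite -andbA condE => AT; have := AT; rewrite -condE => /and3P[_ PT /eqP hA].
rewrite hA; congr (G _ _ * G _ _).
move: AT; rewrite subsetD => /andP[AN disAT].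
by rewrite setDDl -setUA [A :|: _]setUC setUA -splitT // setDDl.
Qed.

End AvoidingWords.

(** * Quasi-Stirling permutations *)

Lemma avoidsE s w : (1 < s)%N -> avoids s w = avoid s gtn w.
Proof.
move=> s_gt1; rewrite /avoids /desc_occ eqn0Ngt -has_count.
apply/hasPn/(avoidP s_gt1) => [avoidw a b c def_w size_b|avoidw j].
  have := avoidw (size a).
  rewrite def_w drop_size_cat // take_size_cat //; apply.
  by rewrite mem_iota !size_cat; lia.
rewrite mem_iota => ltj; apply: (avoidw (take j w) _ (drop s (drop j w))).
  by rewrite !cat_take_drop.
by rewrite size_takel // size_drop; lia.
Qed.

Lemma avoid_map s (T T' : Type) (f : T -> T') r w :
  avoid s r (map f w) = avoid s (relpre f r) w.
Proof.
elim: w => //= x w ->; congr ((_ < s)%N && _).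
by elim: w x => //= y w IHw x; rewrite IHw.
Qed.

Lemma subseq_cons_nth (x : nat) t w :
  reflect (exists2 j, (j < size w)%N
             & nth 0%N w j = x /\ subseq t (drop j.+1 w))
          (subseq (x :: t) w).
Proof.
apply: (iffP idP) => [|[j ltj [<- sub_t]]].
  elim: w => //= y w IHw; case: eqP => [->|_] sub_t.
    by exists 0%N; rewrite // drop0.
  by have [j ltj [xE sub]] := IHw sub_t; exists j.+1.
apply: subseq_trans (drop_subseq w j).
by rewrite (drop_nth 0%N ltj) /= eqxx.
Qed.

Lemma quasi_stirlingP w : reflect (noncrossing w) (quasi_stirling w).
Proof.
rewrite /quasi_stirling; apply: (iffP negP) => [qs x y nxy|nc].
  apply: contra_notN qs => /subseq_cons_nth[j1 lt1 [x1]].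
  case/subseq_cons_nth => j2; rewrite size_drop nth_drop drop_drop => lt2 [y2].
  case/subseq_cons_nth => j3; rewrite size_drop nth_drop drop_drop => lt3 [x3].
  case/subseq_cons_nth => j4; rewrite size_drop nth_drop => lt4 [y4 _].
  have lt2' : (j1.+1 + j2 < size w)%N by rewrite -ltn_subRL.
  have lt3' : (j2.+1 + j1.+1 + j3 < size w)%N by rewrite -ltn_subRL.
  have lt4' : (j3.+1 + (j2.+1 + j1.+1) + j4 < size w)%N by rewrite -ltn_subRL.
  apply/existsP; exists (Ordinal lt1); apply/existsP; exists (Ordinal lt2').
  apply/existsP; exists (Ordinal lt3'); apply/existsP; exists (Ordinal lt4').
  rewrite /= x1 y2 x3 y4 !eqxx nxy; apply/and4P; split=> //; lia.
case/existsP=> j1 /existsP[j2 /existsP[j3 /existsP[j4]]].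
case/and5P=> lt12 lt23 lt34 /eqP x13 /andP[/eqP y24 nxy].
have /negP := nc _ _ nxy; apply.
have [[[lt1 lt2] lt3] lt4] := (ltn_ord j1, ltn_ord j2, ltn_ord j3, ltn_ord j4).
apply/subseq_cons_nth; exists j1 => //; split=> //.
apply/subseq_cons_nth; exists (j2 - j1.+1)%N; first by rewrite size_drop; lia.
rewrite nth_drop drop_drop subnKC //; split=> //.
apply/subseq_cons_nth; exists (j3 - j2.+1)%N; first by rewrite size_drop; lia.
rewrite nth_drop; split; first by rewrite x13; congr nth; lia.
rewrite drop_drop sub1seq y24.
rewrite (_ : (_ + _)%N = j3.+1); last by lia.
rewrite (_ : nth 0%N w j4 = nth 0%N (drop j3.+1 w) (j4 - j3.+1)); last first.
  by rewrite nth_drop subnKC.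
by rewrite mem_nth // size_drop ltn_sub2r // (leq_ltn_trans lt34 lt4).
Qed.

Lemma count_mset_word n k y :
  count_mem y (mset_word n k) = ((0 < y <= n)%N * k y)%N.
Proof.
rewrite /mset_word -[(0 < y <= n)%N]/(1 <= y < 1 + n)%N.
elim: n 1%N => [|n IHn] m /=.
  by rewrite addn0 ltnNge; case: (m <= y)%N.
rewrite count_cat IHn count_nseq /=; have [->|neq] := eqVneq m y.
  by rewrite ltnn leqnn addnS ltnS leq_addr mul0n addn0.
rewrite mul0n add0n addSnnS; congr ((_ && _) * _)%N.
by rewrite ltn_neqAle neq.
Qed.

Section MultisetWords.
Variables (n : nat) (k : nat -> nat).

(** Letters of multiplicity 0 are excluded, since [(extra i).+1] would miscount them; this happens
    for the letter 1 in p_s(0; n, 0). *)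
Definition letters : {set 'I_n.+1} :=
  [set i : 'I_n.+1 | (0 < i)%N && (0 < k i)%N].
Definition extra (i : 'I_n.+1) : nat := (k i).-1.

Lemma perm_quasi_stirling_words :
  perm_eq (quasi_stirling_perms n k)
          (map (map val) (words extra [::] letters)).
Proof.
apply: uniq_perm; first by rewrite filter_uniq ?permutations_uniq.
  by rewrite map_inj_uniq ?words_uniq //; apply: inj_map val_inj.
have countE (w : seq 'I_n.+1) (i : 'I_n.+1) :
    count_mem (val i) (map val w) = count_mem i w.
  by rewrite count_map; apply: eq_count => j /=; rewrite val_eqE.
have lettersE (i : 'I_n.+1) :
    ((i \in letters) * (extra i).+1 = (0 < i <= n)%N * k i)%N.
  by rewrite inE /extra -(ltnS i) ltn_ord andbT; case: (k i) => [|j]; lia.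
move=> v; rewrite mem_filter mem_permutations.
apply/andP/mapP =>
  [[/quasi_stirlingP ncv /allP perm_v]|[w /mem_words[cw ncw] ->]].
  have le_v y : y \in v -> (y <= n)%N.
    move=> yv; have := perm_v y; rewrite mem_cat yv => /(_ isT) /=.
    rewrite count_mset_word => /eqP cy.
    have : (0 < count_mem y v)%N by rewrite -has_count has_pred1.
    by rewrite cy; case: (y <= n)%N; rewrite // andbF.
  have def_v : v = map val (map (@inord n) v).
    rewrite -map_comp -[LHS]map_id; apply/eq_in_map => y yv /=.
    by rewrite inordK // ltnS le_v.
  exists (map (@inord n) v) => //; apply/mem_words; split=> [i|x y nxy].
    rewrite lettersE -countE -def_v -count_mset_word.
    have [iv|] := boolP (val i \in v ++ mset_word n k).
      by apply/eqP/perm_v.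
    by rewrite mem_cat => /norP[/count_memPn-> /count_memPn->].
  apply: contra (ncv (val x) (val y) _) => // sub_v.
  by rewrite def_v; apply: (map_subseq val sub_v).
split.
  apply/quasi_stirlingP => x y nxy; apply/negP => sub_w.
  have mem_w z : z \in [:: x; y; x; y] -> z = val (@inord n z).
    by move/(mem_subseq sub_w)/mapP => -[i _ ->]; rewrite inord_val.
  have nxy' : @inord n x != @inord n y.
    apply: contra nxy => /eqP xy.
    by rewrite (mem_w x) ?inE ?eqxx // xy -mem_w // !inE eqxx orbT.
  have /negP := ncw _ _ nxy'; apply.
  have := map_subseq (@inord n) sub_w; rewrite -map_comp.
  by rewrite (eq_map (g := id)) ?map_id // => i /=; rewrite inord_val.
apply/allP => y _ /=; rewrite count_mset_word; apply/eqP.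
have [ltyn|] := ltnP y n.+1.
  by rewrite -[y]/(val (Ordinal ltyn)) countE cw lettersE.
rewrite ltnNge => ltny; rewrite (negPf ltny) andbF mul0n.
apply/count_memPn/mapP => -[i _ yi]; move: ltny.
by rewrite yi -ltnS ltn_ord.
Qed.

Lemma count_avoids_quasi_stirling s : (1 < s)%N ->
  (count (avoids s) (quasi_stirling_perms n k))%:R
  = lagrange extra (link_egf s) (seg_egf s) letters.
Proof.
move=> s_gt1; have -> := permP perm_quasi_stirling_words (avoids s).
pose r := relpre (val : 'I_n.+1 -> nat) gtn.
have rst : strict_total r.
  split=> [x|y x z|x y]; first exact: ltnn.
    by move=> /= lt_yx lt_zy; apply: ltn_trans lt_zy lt_yx.
  by rewrite -val_eqE neq_ltn orbC.
have := @sum_words_avoid s _ extra s_gt1 r letters [::] rst isT.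
rewrite mul1r => <- //; rewrite count_map -sum1_count natr_sum big_mkcond.
apply: eq_bigr => w _; rewrite /= avoidsE // avoid_map -/r.
by case: (avoid _ _ _).
Qed.

End MultisetWords.

(** * The numbers p_s(0; n, k): recurrence, initial values and series *)

Section Numbers.
Variable s : nat.
Hypothesis s_gt1 : (1 < s)%N.

Definition word_egf k : {fps rat} := seg_egf s * link_egf s ^+ k.

(** This is p_s(0; n + 1, k), as [p0E] shows; the shift is that of Lagrange inversion, where n + 1
    letters call for the n-th coefficient. *)
Definition pnum n k : rat := n`!%:R * (word_egf k)`[n].

Lemma fps_coefXnM (R : comNzRingType) (f : {fps R}) m n :
  (fpsX ^+ m * f)`[n] = if (m <= n)%N then f`[n - m] else 0.
Proof.
elim: m n => [|m IHm] n; first by rewrite expr0 mul1r subn0.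
by rewrite exprS -mulrA; case: n => [|n]; rewrite ?fps_coef0XM ?fps_coefXM ?IHm.
Qed.

(** The rational function is identified by multiplying with 1 - x^s: the weights have period s apart
    from index 0. *)
Lemma W_hatE : W_hat s = run_egf s.
Proof.
have unitX : (1 - fpsX ^+ s : {fps rat}) \is a GRing.unit.
  by rewrite fps_unitE fps_coefB fps_coef1 fps_coefXn 
    (ltn_eqF (ltnW s_gt1)) subr0 unitr1.
have runE : (- fpsX ^+ s + fpsX) / (1 - fpsX ^+ s) = Fps (run_weight s).
  apply: (mulIr unitX); rewrite divrK //; apply/fpsP=> n.
  rewrite mulrC mulrBl mul1r fps_coefB fps_coefXnM fps_coefD fps_coefN.
  rewrite fps_coefXn.
  rewrite [LHS]addrC /run_weight /=; have [lesn|ltns] := leqP s n; last first.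
    rewrite modn_small //= subr0; congr (_ - _%:R).
    case: n ltns => [|n] ltns; first by rewrite (ltn_eqF (ltnW s_gt1)).
    by rewrite gtnNdvd // (ltn_eqF ltns).
  have -> : ((n - s) %% s = n %% s)%N by rewrite -{2}(subnK lesn) modnDr.
  rewrite (dvdn_subl _ (dvdnn s)) // subn_gt0.
  have -> : (n == 1%N) = false by rewrite gtn_eqF // (leq_trans s_gt1).
  have [->|nns] := eqVneq n s.
    by rewrite ltnn dvdnn (ltnW s_gt1) /=; ring.
  have lt_sn : (s < n)%N by rewrite ltn_neqAle eq_sym nns.
  by rewrite lt_sn (leq_trans _ lt_sn) //=; ring.
by rewrite /W_hat runE; apply/fpsP=> n.
Qed.

(** This and [word_egfSE] are the coefficients of y^0 and y^(k+1) in (1 - W - y W') sum_k u phi^k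
    y^k = 1. *)
Lemma word_egf0E : word_egf 0 = 1 + run_egf s * word_egf 0.
Proof. by rewrite /word_egf expr0 mulr1; apply: seg_egfE. Qed.

Lemma word_egfSE k :
  word_egf k.+1 = run_egf s * word_egf k.+1 + fps_deriv (run_egf s) * word_egf k.
Proof.
apply/eqP; rewrite addrC -subr_eq -{1}[word_egf k.+1]mul1r -mulrBl; apply/eqP.
have unitE := mulrV (run_egf_unit s).
rewrite /word_egf exprS /link_egf -/(seg_egf s) in unitE *.
transitivity ((1 - run_egf s) * seg_egf s
  * (seg_egf s * fps_deriv (run_egf s) * (seg_egf s * fps_deriv (run_egf s)) ^+ k)).
  by ring.
by rewrite [X in X * _](unitE) mul1r; ring.
Qed.

Lemma pnumS n : pnum n.+1 0 = pnum n 1.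
Proof.
rewrite /pnum /word_egf expr0 expr1 mulr1 [seg_egf s * _]mulrC.
rewrite -(deriv_seg_egf s).
transitivity (n`!%:R * (n.+1%:R * (seg_egf s)`[n.+1])).
  by rewrite factS natrM mulrA [X in X * _]mulrC.
by congr (_ * _); rewrite mulr_natl.
Qed.

Lemma lagrange_seg (I : finType) (d : I -> nat) (N : {set I}) n :
  #|N| = n.+1 ->
  lagrange d (link_egf s) (seg_egf s) N = pnum n (weight d N).+1.
Proof.
move=> cardN; rewrite /lagrange -cards_eq0 cardN succnK (deriv_seg_egf s).
case: eqP => // _; congr (_ * _`[n]).
by rewrite mulrAC -exprS mulrC.
Qed.

Lemma sum_letters n (F : nat -> nat) :
  (\sum_(i : 'I_n.+1 | 0 < i) F i = \sum_(1 <= l < n.+1) F l)%N.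
Proof. by rewrite big_geq_mkord. Qed.

Lemma card_letters_pos n : #|[set i : 'I_n.+1 | (0 < i)%N]| = n.
Proof.
rewrite -sum1dep_card (sum_letters n (fun=> 1%N)).
by rewrite sum_nat_const_nat muln1 subn1.
Qed.

Lemma count_quasi_stirling_pnum n k :
  (forall l, (1 <= l <= n.+1)%N -> (0 < k l)%N) ->
  (count (avoids s) (quasi_stirling_perms n.+1 k))%:R
  = pnum n (\sum_(1 <= l < n.+2) (k l).-1).+1.
Proof.
move=> k_gt0; rewrite count_avoids_quasi_stirling //.
have lettersE : letters n.+1 k = [set i : 'I_n.+2 | (0 < i)%N].
  apply/setP=> i; rewrite !inE; case i_gt0: (0 < i)%N => //=.
  by apply: k_gt0; rewrite i_gt0 -ltnS ltn_ord.
have cardE : #|letters n.+1 k| = n.+1 by rewrite lettersE card_letters_pos.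
rewrite (lagrange_seg _ cardE) lettersE; congr (pnum _ _.+1).
rewrite -(sum_letters n.+1 (fun l => (k l).-1)); apply: eq_bigl => i.
by rewrite inE.
Qed.

Lemma p0E n k : (p0 s n.+1%:Z k%:Z)%:~R = pnum n k.
Proof.
pose kk l := if l == 1%N then k else 1%N.
have -> : p0 s n.+1%:Z k%:Z
    = (count (avoids s) (quasi_stirling_perms n.+1 kk))%:Z.
  rewrite /= /p_poly horner_sum -/kk /quasi_stirling_perms.
  (* A crossing needs two repeated letters, and only the letter 1 can be repeated. *)
  rewrite (_ : [seq w <- _ | _] = multiperms n.+1 kk).
    rewrite -natz -sum1_count natr_sum [RHS]big_mkcond; apply: eq_bigr => w _.
    by rewrite hornerXn expr0n /avoids; case: eqP.
  apply/all_filterP/allP => w; rewrite mem_permutations => /permP perm_w.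
  apply/quasi_stirlingP => x y nxy; apply/negP => sub_w.
  have count_w z : (count_mem z w <= if z == 1%N then k else 1)%N.
    rewrite perm_w count_mset_word /kk.
    by case: (_ && _); rewrite ?mul1n ?mul0n.
  have := leq_trans (leq_count_subseq (pred1 x) sub_w) (count_w x).
  have := leq_trans (leq_count_subseq (pred1 y) sub_w) (count_w y).
  have nyx : y != x by rewrite eq_sym.
  rewrite /= !eqxx (negPf nxy) (negPf nyx).
  case: (x =P 1%N) => [x1|_]; case: (y =P 1%N) => [y1|_] //=.
  by move: nxy; rewrite x1 y1.
(* For k = 0 the letter 1 is absent: n letters of multiplicity 1 remain, and [pnumS] shifts the
   index back. For n = 0 only the empty word is left. *)
case: k @kk => [|k] kk.
  rewrite -pmulrn count_avoids_quasi_stirling //.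
  have lettersE : letters n.+1 kk = [set i : 'I_n.+2 | (1 < i)%N].
    by apply/setP=> i; rewrite !inE /kk; case: (val i) => [|[|j]].
  have cardE : #|letters n.+1 kk| = n.
    rewrite lettersE -sum1dep_card -(big_geq_mkord _ _ xpredT (fun=> 1%N)).
    by rewrite sum_nat_const_nat muln1 !subSS subn0.
  have weightE : weight (extra kk) (letters n.+1 kk) = 0%N.
    by apply: big1 => i _; rewrite /extra /kk; case: eqP.
  case: n cardE weightE {lettersE} => [|n] cardE weightE.
    rewrite (cards0_eq cardE) lagrange_set0.
    by rewrite /pnum /word_egf fact0 mul1r expr0 mulr1.
  by rewrite (lagrange_seg _ cardE) weightE pnumS.
rewrite -pmulrn count_quasi_stirling_pnum /kk => [|l _]; last by case: eqP.
rewrite big_ltn //= big_nat big1 ?addn0 // => l /andP[l_gt1 _].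
by rewrite gtn_eqF.
Qed.

(** Only the indices s m and s m + 1 carry weight, so the range is cut into blocks of length s; the
    block m = 0 has no negative term. *)
Lemma sum_run_weight_multiples (f : nat -> rat) M :
  \sum_(i < s * M.+1) run_weight s i * f i
  = f 1%N + \sum_(1 <= m < M.+1) (f (s * m + 1)%N - f (s * m)%N).
Proof.
have s_gt0 := ltnW s_gt1.
have block m : \sum_(s * m <= i < s * m.+1) run_weight s i * f i
    = f (s * m + 1)%N - f (s * m)%N *+ (0 < m)%N.
  rewrite -[X in \sum_(X <= _ < _) _]add0n big_addn mulnS addnK.
  rewrite big_ltn // big_ltn // big_nat big1 ?addr0 => [|j /andP[gt1 lts]].
    have m1 : ((s * m + 1) %% s = 1)%N by rewrite mulnC modnMDl modn_small.
    have -> : run_weight s (0 + s * m) = - (0 < m)%N%:R.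
      by rewrite /run_weight modnMr dvdn_mulr // andbT muln_gt0 s_gt0 sub0r.
    have -> : run_weight s (1 + s * m) = 1.
      by rewrite addnC /run_weight m1 /dvdn m1 andbF subr0.
    by rewrite add0n add1n addn1 addrC mul1r mulNr mulr_natl.
  rewrite /run_weight dvdn_addl ?dvdn_mulr // gtnNdvd ?(ltnW gt1) //.
  by rewrite andbF subr0 addnC mulnC modnMDl modn_small // gtn_eqF // mul0r.
rewrite -(big_mkord xpredT (fun i => run_weight s i * f i)).
elim: M => [|M IHM].
  rewrite [in RHS]big_geq // addr0 -[X in \sum_(X <= _ < _) _](muln0 s) block.
  by rewrite muln0 subr0.
rewrite (big_cat_nat (leq0n (s * M.+1)) (leq_mul (leqnn s) (leqnSn M.+1))).
rewrite [LHS]/= IHM block mulr1n.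
by rewrite [in RHS]big_nat_recr // [RHS]addrA.
Qed.

Lemma sum_widen_eq0 (F : nat -> rat) m n : (m <= n)%N ->
  (forall i, (m <= i)%N -> F i = 0) -> \sum_(i < m) F i = \sum_(i < n) F i.
Proof.
move=> lemn F0; rewrite (big_ord_widen n F lemn) big_mkcond.
apply: eq_bigr => i _.
by case: ltnP => // /F0.
Qed.

Lemma pnum_egfM (v : nat -> rat) n k :
  n`!%:R * (egf v * word_egf k)`[n]
  = \sum_(i < n.+1) v i * ('C(n, i)%:R * pnum (n - i) k).
Proof.
rewrite fps_coefM mulr_sumr; apply: eq_bigr => i _.
have lein : (i <= n)%N by rewrite -ltnS.
rewrite /pnum /= -(bin_fact lein) !natrM.
have fact_neq0 : i`!%:R != 0 :> rat by rewrite pnatr_eq0 -lt0n fact_gt0.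
by field.
Qed.

(** Coefficient extraction from [word_egfSE]: the terms [f] come from W, the terms [g] from W'. *)
Lemma pnum_recurrence n k :
  let f i := 'C(n, i)%:R * pnum (n - i) k.+1 in
  let g i := 'C(n, i)%:R * pnum (n - i) k in
  pnum n k.+1
  = \sum_(1 <= m < (n.+1 %/ s).+1)
      (- (f (s * m)%N + g (s * m - 1)%N) + (f (s * m + 1)%N + g (s * m)%N))
    + (f 1%N + g 0%N).
Proof.
move=> f g; have s_gt0 := ltnW s_gt1.
have ltnM : (n.+1 < s * (n.+1 %/ s).+1)%N by rewrite mulnC ltn_ceil.
have C0 i : (n < i)%N -> 'C(n, i)%:R = 0 :> rat.
  by move=> lt_ni; rewrite bin_small.
rewrite {1}/pnum word_egfSE fps_coefD mulrDr deriv_run_egf !pnum_egfM.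
(* The range is extended to a multiple of s; the added binomials vanish. *)
rewrite (sum_widen_eq0 (F := fun i => run_weight s i * f i) (ltnW ltnM));
  last first.
  by move=> i lei; rewrite /f C0 // mul0r mulr0.
(* In W' the weights are shifted by one; shifting the terms instead gives both sums the same
   weights. *)
pose g' i := if i is j.+1 then g j else 0.
transitivity (\sum_(i < s * (n.+1 %/ s).+1) run_weight s i * f i
   + \sum_(i < s * (n.+1 %/ s).+1) run_weight s i * g' i).
  congr (_ + _).
  rewrite -(sum_widen_eq0 (F := fun i => run_weight s i * g' i) ltnM).
    by rewrite [RHS]big_ord_recl mulr0 add0r.
  by case=> // i lei; rewrite /g' /g C0 // mul0r mulr0.
rewrite !sum_run_weight_multiples addrACA [RHS]addrC -big_split /=.
congr (_ + _); apply: eq_big_nat => m /andP[m_gt0 _].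
have -> : g' (s * m + 1)%N = g (s * m)%N by rewrite addn1.
have -> : g' (s * m)%N = g (s * m - 1)%N.
  by rewrite -[in LHS](@prednK (s * m)) ?muln_gt0 ?s_gt0 //= subn1.
by ring.
Qed.

(** The sum over m is empty here, so [pnum n k.+1] is n times [pnum n.-1 k.+1] plus [pnum n k],
    which (n + k)! / k! satisfies. *)
Lemma pnum_initial n k : (n.+1 < s)%N ->
  pnum n k = (n + k)`!%:R / k`!%:R.
Proof.
have fact_neq0 i : i`!%:R != 0 :> rat by rewrite pnatr_eq0 -lt0n fact_gt0.
elim: n k => [|n IHn] k lts; last have {}IHn j := IHn j (ltnW lts).
  elim: k => [|k IHk].
    by rewrite /pnum /word_egf expr0 mulr1 seg_egf0 // fact0 divr1.
  rewrite pnum_recurrence divn_small // big_geq // add0r bin0 subn0 mul1r IHk.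
  by rewrite bin0n mul0r add0r !add0n !divff.
elim: k => [|k IHk]; first by rewrite pnumS IHn addn1 addn0 fact0 !divr1.
rewrite pnum_recurrence divn_small // big_geq // add0r bin1 bin0 subn0 mul1r.
rewrite IHk subn1 /= IHn !addSn addnS !factS !natrM.
by field; rewrite fact_neq0 nat1r pnatr_eq0.
Qed.

(** For [i > n] both sides vanish through the binomial. *)
Lemma binomial_p0 n i k :
  ('C(n, i)%:Z * p0 s (n.+1%:Z - i%:Z) k%:Z)%:~R = 'C(n, i)%:R * pnum (n - i) k.
Proof.
rewrite intrM -pmulrn; have [lein|lt_ni] := leqP i n; last first.
  by rewrite bin_small // !mul0r.
by rewrite subzn ?leqW // subSn // p0E.
Qed.

Lemma P_egfE k : (P_egf s)`[k] = fpsX * word_egf k.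
Proof.
apply/fpsP=> -[|n]; rewrite ?fps_coef0XM ?fps_coefXM //=.
rewrite p0E /pnum mulrC mulKf // pnatr_eq0 -lt0n; exact: fact_gt0.
Qed.

End Numbers.

(** * From the rational coefficients [pnum] back to the integers [p0] *)

Theorem theorem4p8 (s : nat) (hs : (2 <= s)%N) :
  (forall (n : nat) (k : nat -> nat), (1 <= n)%N ->
     (forall l : nat, (1 <= l <= n)%N -> (0 < k l)%N) ->
     let K := (\sum_(1 <= l < n.+1) k l)%N in
     (count (avoids s) (quasi_stirling_perms n k))%:Z
     = p0 s n%:Z (K%:Z - n%:Z + 1))
  /\ (forall n k : nat, (s <= n)%N -> (1 <= k)%N ->
     p0 s n%:Z k%:Z
     = \sum_(1 <= m < (n %/ s).+1)
         (- ('C(n - 1, s * m)%:Z * p0 s (n%:Z - (s * m)%:Z) k%:Z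
             + 'C(n - 1, s * m - 1)%:Z
               * p0 s (n%:Z - (s * m)%:Z + 1) (k%:Z - 1))
          + ('C(n - 1, s * m + 1)%:Z * p0 s (n%:Z - (s * m)%:Z - 1) k%:Z
             + 'C(n - 1, s * m)%:Z * p0 s (n%:Z - (s * m)%:Z) (k%:Z - 1)))
       + ((n%:Z - 1) * p0 s (n%:Z - 1) k%:Z + p0 s n%:Z (k%:Z - 1)))
  /\ (forall n : nat, (2 <= n)%N -> p0 s n%:Z 0 = p0 s (n%:Z - 1) 1)
  /\ (forall n k : nat, (1 <= n <= s - 1)%N ->
     (p0 s n%:Z k%:Z)%:~R = (n + k - 1)`!%:R / k`!%:R :> rat)
  /\ (forall n k : int, (n <= 0) || (k < 0) -> p0 s n k = 0)
  /\ (let D : {fps {fps rat}} :=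
        1 - fps_const (W_hat s) - var_y * fps_const (fps_deriv (W_hat s)) in
      D \is a GRing.unit /\ P_egf s = var_x / D).
Proof.
have rat_inj : injective (intmul 1 : int -> rat) by apply: intr_inj.
have p0S (n : nat) : p0 s n.+2%:Z 0 = p0 s n.+1%:Z 1.
  by apply: rat_inj; rewrite !p0E // pnumS.
split=> [n k n_gt0 k_gt0 K|].
  case: n n_gt0 k_gt0 @K => // n _ k_gt0 K.
  (* K - n counts the repeated occurrences, which is the D of Lagrange inversion. *)
  have KE : K = (n.+1 + \sum_(1 <= l < n.+2) (k l).-1)%N.
    transitivity (\sum_(1 <= l < n.+2) (1 + (k l).-1))%N.
      by apply: eq_big_nat => l lel; rewrite add1n prednK // k_gt0.
    by rewrite big_split /= sum_nat_const_nat muln1 subn1.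
  have -> : (K%:Z - n.+1%:Z + 1 = (\sum_(1 <= l < n.+2) (k l).-1).+1%:Z)%R.
    by rewrite KE; lia.
  by apply: rat_inj; rewrite p0E // -count_quasi_stirling_pnum // pmulrn.
split=> [n k lesn k_gt0|].
  case: n lesn => [|n] lesn; first by move: hs; rewrite leqn0 in lesn; lia.
  case: k k_gt0 => // k _.
  have -> : k.+1%:Z - 1 = k%:Z by lia.
  have -> : n.+1%:Z - 1 = n.+1%:Z - 1%N%:Z by [].
  (* The last two terms are brought to the form of the summands, with binomials C(n, 1) and C(n,
     0). *)
  have n1 : n.+1%:Z - 1%N%:Z = 'C(n, 1)%:Z by rewrite bin1; lia.
  have n0 : p0 s n.+1%:Z k%:Z = 'C(n, 0)%:Z * p0 s (n.+1%:Z - 0%N%:Z) k%:Z.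
    by rewrite bin0 mul1r subr0.
  rewrite {1}n1 n0; apply: rat_inj; rewrite p0E // pnum_recurrence // !intrD.
  rewrite (big_morph _ (@intrD rat) (mulr0z 1)) !binomial_p0 // subSS subn0.
  congr (_ + _).
  apply: eq_big_nat => m /andP[m_gt0 _]; have sm_gt0 : (0 < s * m)%N by lia.
  have -> : n.+1%:Z - (s * m)%N%:Z + 1 = n.+1%:Z - (s * m - 1)%N%:Z by lia.
  have -> : n.+1%:Z - (s * m)%N%:Z - 1 = n.+1%:Z - (s * m + 1)%N%:Z by lia.
  by rewrite !(intrD, mulrNz) !binomial_p0.
split=> [[|[|n]] //|].
split=> [[|n] k // len|].
  rewrite p0E // pnum_initial //; last by lia.
  by rewrite addSn subn1.
split=> [[[|n]|n] [k|k]|] //.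
(* The generating function is verified as D P = x, one power of y at a time. *)
move=> D; have coefD F n : (D * F)`[n] = F`[n] - W_hat s * F`[n]
    - (fpsX * (fps_const (fps_deriv (W_hat s)) * F))`[n].
  by rewrite /D !mulrBl mul1r -mulrA !fps_coefB fps_coefCM.
have unitD : D \is a GRing.unit.
  rewrite fps_unitE -[D]mulr1 coefD fps_coef1 fps_coef0XM subr0 mulr1.
  by rewrite W_hatE // run_egf_unit.
split=> //; apply: (mulIr unitD); rewrite divrK // mulrC; apply/fpsP=> n.
rewrite coefD W_hatE //; case: n => [|k].
  rewrite fps_coef0XM subr0 P_egfE //.
  transitivity (fpsX * (word_egf s 0 - run_egf s * word_egf s 0)); first by ring.
  by rewrite {1}word_egf0E addrK mulr1.
rewrite fps_coefXM fps_coefCM !P_egfE //.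
transitivity (fpsX * (word_egf s k.+1 - run_egf s * word_egf s k.+1
  - fps_deriv (run_egf s) * word_egf s k)); first by ring.
by rewrite {1}word_egfSE // addrAC addrK subrr mulr0.
Qed.
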